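(* For every fixed integer $d$, there exists an algorithm that, given a $\forall\exists$-QBF$_d$ instance $\phi=\forall\mathbf{y}\,\exists\mathbf{x}\,\psi$, decides whether $\phi$ is true in time $k^{O_d(k^{d-1})}\cdot|\phi|^{O(1)}$, where $k=|\mathbf{x}|$ is the number of existentially quantified variables.
   Context: A $\forall\exists$-QBF$_d$ instance is a quantified Boolean formula $\forall\mathbf{y}\,\exists\mathbf{x}\,\psi$ where $\mathbf{y},\mathbf{x}$ are tuples of Boolean variables and $\psi$ is in $d$-CNF (a conjunction of clauses each with at most $d$ literals) over $\mathbf{y}\cup\mathbf{x}$. The notation $O_d(\cdot)$ hides factors depending only on $d$; $|\phi|$ denotes the size of the formula. *)

(* Defs.v *)
From mathcomp Require Import all_boot.

Set Implicit Arguments.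
Unset Strict Implicit.
Unset Printing Implicit Defensive.

(* A literal is (s, v): the variable v if s = true, its negation if s = false;
   inl i is the universal variable y_i and inr j the existential variable x_j. *)
Definition literal (n k : nat) := (bool * ('I_n + 'I_k))%type.
Definition clause (n k : nat) := seq (literal n k).

Record qbf := Qbf {
  nall : nat;
  nex : nat;
  clauses : seq (clause nall nex)
}.

Definition lit_val n k (y : {ffun 'I_n -> bool}) (x : {ffun 'I_k -> bool})
    (l : literal n k) : bool :=
  l.1 == match l.2 with inl i => y i | inr j => x j end.

Definition cnf_val n k (cs : seq (clause n k))
    (y : {ffun 'I_n -> bool}) (x : {ffun 'I_k -> bool}) : bool :=
  all (has (lit_val y x)) cs.

Definition qbf_true (phi : qbf) : bool :=
  [forall y : {ffun 'I_(nall phi) -> bool},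
    [exists x : {ffun 'I_(nex phi) -> bool}, cnf_val (clauses phi) y x]].

Definition is_dcnf (d : nat) (phi : qbf) : bool :=
  all (fun C => size C <= d) (clauses phi).

(* Number of symbols: the two quantifiers, the variables they bind, one symbol
   per clause and one per literal occurrence. *)
Definition qbf_size (phi : qbf) : nat :=
  (nall phi + nex phi + \sum_(C <- clauses phi) (size C).+1).+2.

(* The unit-cost RAM of Cook and Reckhow over the natural numbers. The only
   arithmetic is addition and truncated subtraction, so that running times are
   polynomially related to those of Turing machines. The first argument of an
   instruction is its target register, except that WriteMem i j stores register j
   at the address held in register i, and JumpPos i a jumps to line a if
   register i is positive. *)
Inductive instr :=
| SetConst of nat & nat
| SetAdd of nat & nat & nat
| SetSub of nat & nat & nat
| ReadMem of nat & nat
| WriteMem of nat & nat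
| JumpPos of nat & nat.

Definition program := seq instr.

Record state := State {
  pc : nat;
  register : nat -> nat;
  memory : nat -> nat
}.

Definition exec (c : instr) (s : state) : state :=
  let: State p r M := s in
  match c with
  | SetConst i c => State p.+1 [eta r with i |-> c] M
  | SetAdd i j l => State p.+1 [eta r with i |-> r j + r l] M
  | SetSub i j l => State p.+1 [eta r with i |-> r j - r l] M
  | ReadMem i j => State p.+1 [eta r with i |-> M (r j)] M
  | WriteMem i j => State p.+1 r [eta M with r i |-> r j]
  | JumpPos i a => State (if 0 < r i then a else p.+1) r M
  end.

(* The machine halts by leaving the program; a halted state is a fixed point of
   step, so that "halted after t steps" means "halts within t steps". *)
Definition halted (P : program) (s : state) : bool := size P <= pc s.

Definition step (P : program) (s : state) : state :=
  if onth P (pc s) is Some c then exec c s else s.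

(* The input word occupies memory cells 0, 1, ...; register 0 holds its length;
   all other registers and memory cells are 0. *)
Definition init (w : seq nat) : state :=
  State 0 [eta (fun=> 0) with 0 |-> size w] (nth 0 w).

Definition outputs_within (P : program) (w : seq nat) (b : bool) (t : nat) :=
  let s := iter t (step P) (init w) in
  halted P s /\ register s 0 = b.

(* Three words per literal: sign, block (0 universal, 1 existential), index. *)
Definition enc_literal n k (l : literal n k) : seq nat :=
  match l.2 with
  | inl i => [:: nat_of_bool l.1; 0; nat_of_ord i]
  | inr j => [:: nat_of_bool l.1; 1; nat_of_ord j]
  end.

Definition enc_clause n k (C : clause n k) : seq nat :=
  size C :: flatten (map (@enc_literal n k) C).

Definition enc_qbf (phi : qbf) : seq nat :=
  [:: nall phi; nex phi; size (clauses phi)]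
  ++ flatten (map (@enc_clause _ _) (clauses phi)).

Definition decides_within (P : program) (phi : qbf) (t : nat) :=
  outputs_within P (enc_qbf phi) (qbf_true phi) t.

(* Main.v *)
Require Import Defs.
From mathcomp Require Import all_boot.
From mathcomp Require Import zify.

(** The formula is false iff some y falsifies psi for every x, and whether a given
    y does so is checked by brute force over all 2^k assignments of x. So it
    suffices to try few candidates y, as long as one of them works if any y does.

    Group the clauses by their existential literals: a clause that has a universal
    literal lies in one of N = (2k+1)^(d-1) groups. If y* works, so does every y
    that falsifies the universal part of some clause in each group G where y* does.
    Such a y is built by fixing few variables. In G, greedily pick clauses that can
    still be falsified and whose unassigned variables are disjoint, and let H be the
    set of these variables. If H is small, then every clause of G that can still be
    falsified meets H, so d rounds, each fixing one variable of H as in y*, falsify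
    a clause of G. If H is large, then G can wait: the variables fixed in total,
    D = d (d+1) N at most, cannot meet all the disjoint clauses, so a clause that can
    still be falsified is left when all the other groups are done. Every choice is a
    digit below B = d D, and (3d-1)(d+1) N digits are enough, which gives
    k^(O_d(k^(d-1))) candidates if d >= 2.

    For d <= 1 the factor 2^k is not affordable, but all clauses are then unit
    clauses, and one pass over them detects conflicts. *)

Set Implicit Arguments.
Unset Strict Implicit.
Unset Printing Implicit Defensive.

(** * A loop language compiled to the machine *)

Inductive expr :=
| Const of nat
| Var of nat
| Add of expr & expr
| Sub of expr & expr
| Inp of expr
| Arr of nat & expr.

(** [Loop x c] reads its bound once, on entry, so every command terminates and its running time is
    governed by the values of the loop bounds. *)
Inductive cmd :=
| Asg of nat & expr
| Wr of nat & expr & expr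
| Seq of cmd & cmd
| When of expr & cmd
| Loop of nat & cmd.

Record store := Store { var : nat -> nat; arr : nat -> nat -> nat }.

Definition upd T (f : nat -> T) (x : nat) (v : T) : nat -> T :=
  fun y => if y == x then v else f y.

Section Semantics.
Variable w : seq nat.

Fixpoint eval (e : expr) (s : store) : nat :=
  match e with
  | Const c => c
  | Var x => var s x
  | Add e1 e2 => eval e1 s + eval e2 s
  | Sub e1 e2 => eval e1 s - eval e2 s
  | Inp e => nth 0 w (eval e s)
  | Arr a e => arr s a (eval e s)
  end.

Fixpoint den (c : cmd) (s : store) : store :=
  match c with
  | Asg x e => Store (upd (var s) x (eval e s)) (arr s)
  | Wr a e1 e2 =>
      Store (var s) (upd (arr s) a (upd (arr s a) (eval e1 s) (eval e2 s)))
  | Seq c1 c2 => den c2 (den c1 s)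
  | When e c => if 0 < eval e s then den c s else s
  | Loop x c => iter (var s x) (den c) s
  end.

Fixpoint wvars (c : cmd) : seq nat :=
  match c with
  | Asg x _ => [:: x]
  | Wr _ _ _ => [::]
  | Seq c1 c2 => wvars c1 ++ wvars c2
  | When _ c | Loop _ c => wvars c
  end.

Fixpoint warrs (c : cmd) : seq nat :=
  match c with
  | Asg _ _ => [::]
  | Wr a _ _ => [:: a]
  | Seq c1 c2 => warrs c1 ++ warrs c2
  | When _ c | Loop _ c => warrs c
  end.

Fixpoint lvars (c : cmd) : seq nat :=
  match c with
  | Asg _ _ | Wr _ _ _ => [::]
  | Seq c1 c2 => lvars c1 ++ lvars c2
  | When _ c => lvars c
  | Loop x c => x :: lvars c
  end.

Lemma var_frame c s x : x \notin wvars c -> var (den c s) x = var s x.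
Proof.
elim: c s => [y e|a e1 e2|c1 IH1 c2 IH2|e c IH|y c IH] s //=.
- by rewrite inE /upd => /negbTE ->.
- by rewrite mem_cat negb_or => /andP[h1 h2]; rewrite IH2 ?IH1.
- by move=> h; case: ifP => // _; exact: IH.
- by move=> h; elim: (var s y) => //= n <-; exact: IH.
Qed.

Lemma arr_frame c s a : a \notin warrs c -> arr (den c s) a = arr s a.
Proof.
elim: c s => [y e|b e1 e2|c1 IH1 c2 IH2|e c IH|y c IH] s //=.
- by rewrite inE /upd => /negbTE ->.
- by rewrite mem_cat negb_or => /andP[h1 h2]; rewrite IH2 ?IH1.
- by move=> h; case: ifP => // _; exact: IH.
- by move=> h; elim: (var s y) => //= n <-; exact: IH.
Qed.

(* Odd registers are private to the compiler: 1, 3 and 5 hold the length of the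
   input, the constant 1 and the constant 0; the others are loop counters and
   temporaries. *)
Definition vreg (x : nat) := x.*2.
Definition treg (f : nat) := f.*2.+1.
Arguments vreg _ : simpl never.
Arguments treg _ : simpl never.

(* Entry i of array a lives at address size w + 2 ^ a * (2 i + 1), so that no two
   entries overlap and the cell at address size w stays 0. *)
Definition comp_addr (a f : nat) : seq instr :=
  [:: SetAdd (treg f) (treg f) (treg f); SetAdd (treg f) (treg f) (treg 1)]
  ++ nseq a (SetAdd (treg f) (treg f) (treg f))
  ++ [:: SetAdd (treg f) (treg f) (treg 0)].

Fixpoint comp_expr (e : expr) (f : nat) : seq instr :=
  match e with
  | Const c => [:: SetConst (treg f) c]
  | Var x => [:: SetAdd (treg f) (vreg x) (treg 2)]
  | Add e1 e2 => comp_expr e1 f ++ comp_expr e2 f.+1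
                 ++ [:: SetAdd (treg f) (treg f) (treg f.+1)]
  | Sub e1 e2 => comp_expr e1 f ++ comp_expr e2 f.+1
                 ++ [:: SetSub (treg f) (treg f) (treg f.+1)]
  | Inp e => comp_expr e f
             ++ [:: SetSub (treg f.+1) (treg f) (treg 0);
                    SetSub (treg f) (treg f) (treg f.+1);
                    ReadMem (treg f) (treg f)]
  | Arr a e => comp_expr e f ++ comp_addr a f ++ [:: ReadMem (treg f) (treg f)]
  end.

Fixpoint comp (c : cmd) (f b : nat) : seq instr :=
  match c with
  | Asg x e => comp_expr e f ++ [:: SetAdd (vreg x) (treg f) (treg 2)]
  | Wr a e1 e2 => comp_expr e1 f ++ comp_addr a f ++ comp_expr e2 f.+1
                  ++ [:: WriteMem (treg f) (treg f.+1)]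
  | Seq c1 c2 => let p := comp c1 f b in p ++ comp c2 f (b + size p)
  | When e c =>
      let p := comp_expr e f in
      let q := comp c f (b + size p + 2) in
      p ++ [:: JumpPos (treg f) (b + size p + 2);
               JumpPos (treg 1) (b + size p + 2 + size q)] ++ q
  | Loop x c =>
      let q := comp c f.+1 (b + 2) in
      [:: SetAdd (treg f) (vreg x) (treg 2); JumpPos (treg 1) (b + size q + 3)]
      ++ q ++ [:: SetSub (treg f) (treg f) (treg 1); JumpPos (treg f) (b + 2)]
  end.

(** * Simulation of expressions by the machine *)

Definition code_at (P : program) (b : nat) (p : seq instr) : Prop :=
  exists l r, P = l ++ p ++ r /\ size l = b.

Lemma code_at_cat P b p q :
  code_at P b (p ++ q) -> code_at P b p /\ code_at P (b + size p) q.
Proof.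
move=> [l [r [-> <-]]]; split.
  by exists l, (q ++ r); rewrite !catA.
by exists (l ++ p), r; rewrite size_cat !catA.
Qed.

Lemma code_at_cons P b i p :
  code_at P b (i :: p) -> code_at P b [:: i] /\ code_at P b.+1 p.
Proof. by rewrite -cat1s => /code_at_cat; rewrite addn1. Qed.

Lemma step_at P b i r M :
  code_at P b [:: i] -> step P (State b r M) = exec i (State b r M).
Proof.
move=> [l [q [-> <-]]]; rewrite /step /=.
suff -> : onth (l ++ i :: q) (size l) = Some i by [].
by elim: l.
Qed.

(** The input clause includes the address [size w], where both sides are 0; reads past the input are
    redirected to that cell. *)
Definition sim (s : store) (r M : nat -> nat) : Prop :=
  [/\ forall x, r (vreg x) = var s x,
      [/\ r (treg 0) = size w, r (treg 1) = 1 & r (treg 2) = 0],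
      forall i, i <= size w -> M i = nth 0 w i &
      forall a i, M (size w + 2 ^ a * i.*2.+1) = arr s a i].

Definition keeps (f : nat) (r r' : nat -> nat) : Prop :=
  (forall x, r' (vreg x) = r (vreg x)) /\
  (forall g, g < f -> r' (treg g) = r (treg g)).

Lemma vtreg x g : (vreg x == treg g) = false.
Proof. by rewrite /vreg /treg; apply/negbTE/eqP; lia. Qed.

Lemma tvreg x g : (treg g == vreg x) = false.
Proof. by rewrite eq_sym vtreg. Qed.

Lemma vregE x y : (vreg x == vreg y) = (x == y).
Proof. by rewrite /vreg; apply/eqP/eqP; lia. Qed.

Lemma tregE x y : (treg x == treg y) = (x == y).
Proof. by rewrite /treg; apply/eqP/eqP; lia. Qed.

Lemma keeps_trans f g r1 r2 r3 :
  f <= g -> keeps f r1 r2 -> keeps g r2 r3 -> keeps f r1 r3.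
Proof.
move=> fg [a1 b1] [a2 b2]; split=> [x|h hf]; first by rewrite a2.
by rewrite b2 ?b1 // (leq_trans hf).
Qed.

Lemma keeps_set f g r v :
  f <= g -> keeps f r [eta r with treg g |-> v].
Proof.
move=> fg; split=> [x|h hf] /=; first by rewrite vtreg.
by rewrite tregE ltn_eqF // (leq_trans hf).
Qed.

Lemma sim_keeps f s r r' M : 3 <= f -> keeps f r r' -> sim s r M -> sim s r' M.
Proof.
move=> f3 [k1 k2] [h1 [h2 h3 h4] h5 h6]; split=> //.
  by move=> x; rewrite k1.
by rewrite !k2 ?(leq_trans _ f3).
Qed.

Lemma comp_addrP P b a f r M i :
  3 <= f -> code_at P b (comp_addr a f) ->
  r (treg 0) = size w -> r (treg 1) = 1 -> r (treg f) = i ->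
  exists r', [/\ iter (size (comp_addr a f)) (step P) (State b r M)
                 = State (b + size (comp_addr a f)) r' M,
                 r' (treg f) = size w + 2 ^ a * i.*2.+1 & keeps f r r'].
Proof.
move=> f3 /code_at_cat[/code_at_cons[c1 c2]] /code_at_cat[c3 c4] r0 r1 ri.
have dbl : forall a b r, code_at P b (nseq a (SetAdd (treg f) (treg f) (treg f))) ->
  exists r', [/\ iter a (step P) (State b r M) = State (b + a) r' M,
                 r' (treg f) = 2 ^ a * r (treg f) & keeps f r r'].
  elim=> [|n IH] b' r'.
    by move=> _; exists r'; rewrite addn0 mul1n.
  rewrite -[nseq _ _]/(_ :: nseq n _) => /code_at_cons[h1 h2].
  have [r2 [e2 v2 k2]] := IH _ [eta r' with treg f |-> r' (treg f) + r' (treg f)] h2.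
  exists r2; split.
  - by rewrite iterSr (step_at _ _ h1) /= e2 addnS.
  - by rewrite v2 /= eqxx expnS; lia.
  - exact: keeps_trans (leqnn _) (keeps_set _ _ (leqnn _)) k2.
set ra := [eta r with treg f |-> i + i].
set rb := [eta ra with treg f |-> ra (treg f) + ra (treg 1)].
have c3' : code_at P (b + 2) (nseq a (SetAdd (treg f) (treg f) (treg f))) by [].
have [r2 [e2 v2 k2]] := dbl a _ rb c3'.
have e1 : iter 2 (step P) (State b r M) = State (b + 2) rb M.
  by rewrite /= (step_at _ _ c1) /= ri (step_at _ _ c2) /= addn2.
have f0 : (0 == f) = false by case: (f) f3.
have f1 : (1 == f) = false by case: (f) f3 => [|[]].
have k01 : keeps f r rb.
  by apply: keeps_trans (leqnn f) (keeps_set _ _ (leqnn _)) (keeps_set _ _ (leqnn _)).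
exists [eta r2 with treg f |-> r2 (treg f) + r2 (treg 0)]; split.
- have -> : size (comp_addr a f) = (a + 2).+1.
    by rewrite /comp_addr !size_cat size_nseq /=; lia.
  rewrite iterS iterD e1 e2.
  have -> : b + (a + 2).+1 = (b + 2 + a).+1 by lia.
  by rewrite (step_at _ _ (i := SetAdd (treg f) (treg f) (treg 0))) //; move: c4; rewrite /= size_nseq.
- have kk := keeps_trans (leqnn f) k01 k2.

  rewrite /= eqxx (proj2 kk 0) ?(leq_trans _ f3) // r0 v2 /rb /= ?eqxx /ra /= ?eqxx.
  rewrite tregE f1 r1; lia.
- apply: keeps_trans (leqnn f) k01 _.
  by apply: keeps_trans (leqnn f) k2 (keeps_set _ _ (leqnn f)).
Qed.

Lemma comp_exprP P e f b s r M :
  3 <= f -> code_at P b (comp_expr e f) -> sim s r M ->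
  exists r', [/\ iter (size (comp_expr e f)) (step P) (State b r M)
                 = State (b + size (comp_expr e f)) r' M,
                 r' (treg f) = eval e s & keeps f r r'].
Proof.
elim: e f b r => [c|x|e1 IH1 e2 IH2|e1 IH1 e2 IH2|e IH|a e IH] f b r f3; last 1 first.
- rewrite -[comp_expr _ _]/(_ ++ _ ++ _) => /code_at_cat[c1 /code_at_cat[c2 c3]] hs.
  have [r1 [i1 v1 k1]] := IH _ _ _ f3 c1 hs.
  have [_ [w0 w1 _] _ ha] := sim_keeps f3 k1 hs.
  have [r2 [i2 v2 k2]] := comp_addrP M f3 c2 w0 w1 v1.
  exists [eta r2 with treg f |-> M (r2 (treg f))].
  rewrite [in X in [/\ _, X & _]]/= eqxx v2 ha.
  have -> : size (comp_expr (Arr a e) f) = (size (comp_addr a f) + size (comp_expr e f)).+1.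
    by rewrite !size_cat addn1 addnS addnC.
  split=> //.
    rewrite iterS iterD i1 i2 (step_at _ _ c3) [size (comp_addr a f) + _]addnC addnS addnA.
    by move: (_ + _) => p; rewrite /= v2 ha.
  exact: keeps_trans (leqnn _) (keeps_trans (leqnn _) k1 k2) (keeps_set _ _ (leqnn f)).
- move=> /= h [h1 [h2 h3 h4] h5 h6]; exists [eta r with treg f |-> c].
  rewrite (step_at _ _ h) /= addn1 eqxx; split=> //; exact: keeps_set.
- move=> /= h [h1 [h2 h3 h4] h5 h6]; exists [eta r with treg f |-> var s x].
  rewrite (step_at _ _ h) /= addn1 eqxx h1 h4 addn0; split=> //; exact: keeps_set.
- move=> /= /code_at_cat[c1 /code_at_cat[c2 c3]] hs.
  have [r1 [i1 v1 k1]] := IH1 _ _ _ f3 c1 hs.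
  have [r2 [i2 v2 k2]] := IH2 _ _ _ (leqW f3) c2 (sim_keeps f3 k1 hs).
  exists [eta r2 with treg f |-> r2 (treg f) + r2 (treg f.+1)].
  rewrite !size_cat /= eqxx (proj2 k2) // v1 v2; split=> //.
    rewrite addnA addn1 /= addnC iterD i1 i2 (step_at _ _ c3) /=.
    by rewrite (proj2 k2) // v1 v2; congr State; lia.
  exact: keeps_trans (leqnn _) (keeps_trans (leqnSn _) k1 k2) (keeps_set _ _ (leqnn f)).
- move=> /= /code_at_cat[c1 /code_at_cat[c2 c3]] hs.
  have [r1 [i1 v1 k1]] := IH1 _ _ _ f3 c1 hs.
  have [r2 [i2 v2 k2]] := IH2 _ _ _ (leqW f3) c2 (sim_keeps f3 k1 hs).
  exists [eta r2 with treg f |-> r2 (treg f) - r2 (treg f.+1)].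
  rewrite !size_cat /= eqxx (proj2 k2) // v1 v2; split=> //.
    rewrite addnA addn1 /= addnC iterD i1 i2 (step_at _ _ c3) /=.
    by rewrite (proj2 k2) // v1 v2; congr State; lia.
  exact: keeps_trans (leqnn _) (keeps_trans (leqnSn _) k1 k2) (keeps_set _ _ (leqnn f)).
- move=> /= /code_at_cat[c1 /code_at_cons[c2 /code_at_cons[c3 c4]]] hs.
  have [r1 [i1 v1 k1]] := IH _ _ _ f3 c1 hs.
  have [_ [w0 _ _] hin _] := sim_keeps f3 k1 hs.
  (* The two subtractions leave the minimum of the address and [size w], so that an address past the
     input yields 0. *)
  set r2 := [eta r1 with treg f.+1 |-> r1 (treg f) - r1 (treg 0)].
  set r3 := [eta r2 with treg f |-> r2 (treg f) - r2 (treg f.+1)].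
  exists [eta r3 with treg f |-> M (r3 (treg f))]; split.
  + rewrite size_cat /= addn3 /= i1 (step_at _ _ c2) /= (step_at _ _ c3) /=.
    by rewrite (step_at _ _ c4) /=; congr State; lia.
  + rewrite /= ?eqxx /r3 /= ?eqxx /r2 /= ?eqxx ?tregE ltn_eqF // ?tregE ?eqxx v1 w0.
    rewrite hin; last by lia.
    case: (leqP (eval e s) (size w)) => h.
      by congr nth; lia.
    by rewrite !nth_default //; lia.
  + apply: keeps_trans (leqnn _) k1 _.
    apply: keeps_trans (leqnn _) (keeps_set _ _ (leqnSn f)) _.
    exact: keeps_trans (leqnn _) (keeps_set _ _ (leqnn f)) (keeps_set _ _ (leqnn f)).
Qed.

(** * Running time of compiled commands *)

Definition runs_in (c : cmd) (s : store) (t : nat) : Prop :=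
  forall P f b r M, 3 <= f -> code_at P b (comp c f b) -> sim s r M ->
  exists r' M' u,
    [/\ u <= t, iter u (step P) (State b r M) = State (b + size (comp c f b)) r' M',
        sim (den c s) r' M' & forall g, g < f -> r' (treg g) = r (treg g)].

Lemma runs_in_le c s t u : t <= u -> runs_in c s t -> runs_in c s u.
Proof.
move=> tu h P f b r M f3 hc hs; have [r' [M' [v [h1 h2 h3 h4]]]] := h P f b r M f3 hc hs.
by exists r', M', v; split=> //; apply: leq_trans tu.
Qed.

Lemma runs_in_seq c1 c2 s t1 t2 :
  runs_in c1 s t1 -> runs_in c2 (den c1 s) t2 -> runs_in (Seq c1 c2) s (t1 + t2).
Proof.
move=> h1 h2 P f b r M f3 /= /code_at_cat[k1 k2] hs.
have [r1 [M1 [u1 [l1 i1 s1 p1]]]] := h1 P f b r M f3 k1 hs.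
have [r2 [M2 [u2 [l2 i2 s2 p2]]]] := h2 P f _ r1 M1 f3 k2 s1.
exists r2, M2, (u2 + u1); split=> //.
- by rewrite addnC leq_add.
- by rewrite iterD i1 i2 size_cat addnA.
- by move=> g gf; rewrite p2 ?p1.
Qed.

(** A positive number is a power of two times an odd number in only one way; hence distinct array
    entries have distinct addresses. *)
Lemma odd_pow2_inj a b i j : 2 ^ a * i.*2.+1 = 2 ^ b * j.*2.+1 -> a = b /\ i = j.
Proof.
elim: a b => [|a IH] [|b]; rewrite ?expnS ?mul1n.
- by split=> //; lia.
- by rewrite -mulnA; lia.
- by rewrite -mulnA; lia.
rewrite -!mulnA => /eqP; rewrite eqn_pmul2l // => /eqP /IH[-> ->] //.
Qed.

Lemma size_comp_expr e f : size (comp_expr e f) = size (comp_expr e 0).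
Proof.
elim: e f => [c|x|e1 IH1 e2 IH2|e1 IH1 e2 IH2|e IH|a e IH] f //=;
  rewrite !size_cat /= ?size_cat ?size_nseq /=.
- by rewrite (IH1 f) (IH2 f.+1) (IH2 1).
- by rewrite (IH1 f) (IH2 f.+1) (IH2 1).
- by rewrite (IH f).
- by rewrite (IH f).
Qed.

Lemma runs_in_asg x e s : runs_in (Asg x e) s (size (comp_expr e 0)).+1.
Proof.
move=> P f b r M f3 /= /code_at_cat[k1 k2] hs.
have [r1 [i1 v1 p1]] := comp_exprP f3 k1 hs.
have [q1 [q2 q3 q4] q5 q6] := sim_keeps f3 p1 hs.
exists [eta r1 with vreg x |-> eval e s], M, (size (comp_expr e 0)).+1; split=> //.
- rewrite -(size_comp_expr e f) iterS i1 (step_at _ _ k2) /= v1 q4 addn0 size_cat /=.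
  by rewrite addn1 addnS.
- split=> //=; last by rewrite !tvreg.
  by move=> y; rewrite vregE q1 /upd.
- by move=> g gf /=; rewrite tvreg; exact: (proj2 p1).
Qed.

Definition time_wr a e1 e2 :=
  size (comp_expr e1 0) + size (comp_addr a 0) + size (comp_expr e2 0) + 1.

Lemma runs_in_wr a e1 e2 s : runs_in (Wr a e1 e2) s (time_wr a e1 e2).
Proof.
move=> P f b r M f3; rewrite -[comp _ _ _]/(_ ++ _ ++ _ ++ _).
move=> /code_at_cat[k1 /code_at_cat[k2 /code_at_cat[k3 k4]]] hs.
have [r1 [i1 v1 p1]] := comp_exprP f3 k1 hs.
have hs1 := sim_keeps f3 p1 hs.
have [_ [w0 w1 _] _ _] := hs1.
have [r2 [i2 v2 p2]] := comp_addrP M f3 k2 w0 w1 v1.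
have hs2 := sim_keeps f3 p2 hs1.
have [r3 [i3 v3 p3]] := comp_exprP (leqW f3) k3 hs2.
have hs3 := sim_keeps (leqW f3) p3 hs2.
have [q1 [q2 q3 q4] q5 q6] := hs3.
exists r3, [eta M with r3 (treg f) |-> r3 (treg f.+1)], (time_wr a e1 e2).
have sa : size (comp_addr a f) = size (comp_addr a 0).
  by rewrite /comp_addr !size_cat !size_nseq.
split=> //.
- rewrite /time_wr -sa -(size_comp_expr e1 f) -(size_comp_expr e2 f.+1).
  rewrite addn1 iterS addnC [size (comp_expr e1 f) + _]addnC.
  rewrite !iterD i1 i2 i3 (step_at _ _ k4) !size_cat addn1 !addnS !addnA.
  by rewrite /=; congr State; lia.
- split=> //= [i iw|c i].
    rewrite (proj2 p3) // v2; case: eqP => [h|_]; last exact: q5.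
    by move: iw; rewrite h; have := expn_gt0 2 a; lia.
  rewrite (proj2 p3) // v2 v3 /upd eqn_add2l.
  case: eqP => [/odd_pow2_inj[-> ->]|h]; first by rewrite !eqxx.
  rewrite q6; case: eqP => // ca; case: eqP => [ie|_]; last by rewrite ca.
  by exfalso; apply: h; rewrite ca ie.
- by move=> g gf; rewrite (proj2 p3) ?(proj2 p2) ?(proj2 p1) // ltnW.
Qed.

Lemma runs_in_when e c s t :
  runs_in c s t -> runs_in (When e c) s (size (comp_expr e 0) + t + 2).
Proof.
move=> h P f b r M f3 /= /code_at_cat[k1 /code_at_cons[k2 /code_at_cons[k3 k4]]] hs.
have [r1 [i1 v1 p1]] := comp_exprP f3 k1 hs.
have hs1 := sim_keeps f3 p1 hs.
have [_ [_ w1 _] _ _] := hs1.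
rewrite -addn2 in k4.
rewrite -(size_comp_expr e f) !size_cat /=.
case: (posnP (eval e s)) => he.
  exists r1, M, (size (comp_expr e f)).+2; split=> //; first by lia.
    rewrite !iterS i1 (step_at _ _ k2) /= v1 he /= (step_at _ _ k3) /= w1 /=.
    by congr State; lia.
  exact: (proj2 p1).
have [r2 [M2 [u [l2 i2 s2 p2]]]] := h P f _ r1 M f3 k4 hs1.
exists r2, M2, (u + (size (comp_expr e f)).+1); split=> //; first by lia.
  rewrite iterD iterS i1 (step_at _ _ k2) /= v1 he /= i2.
  by congr State; lia.
by move=> g gf; rewrite p2 ?(proj2 p1).
Qed.

Lemma runs_in_loop x c s t n :
  var s x <= n -> (forall i, i < var s x -> runs_in c (iter i (den c) s) t) ->
  runs_in (Loop x c) s (3 + n * (t + 2)).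
Proof.
move=> xn h P f b r M f3 /= /code_at_cons[k1 /code_at_cons[k2]].
move=> /code_at_cat[k3 /code_at_cons[k4 k5]] hs.
set q := comp c f.+1 (b + 2) in k2 k3 k4 k5 *.
rewrite size_cat /=.
set m := var s x.
have [q1 [q2 q3 q4] _ _] := hs.
set r1 := [eta r with treg f |-> m].
have kk := keeps_set r m (leqnn f).
have init : iter 2 (step P) (State b r M) = State (b + size q + 3) r1 M.
  rewrite /= (step_at _ _ k1) /= q1 q4 addn0 (step_at _ _ k2) /=.
  by rewrite tregE ltn_eqF ?(leq_trans _ f3) // q3.
(* The entry code jumps straight to the test at the bottom, [b + size q + 3]. The invariant
   describes the state there after [i] passes, with [m - i] left in the counter. *)
have main : forall i, i <= m -> exists r' M' u,
  [/\ u <= i * (t + 2), iter u (step P) (State (b + size q + 3) r1 M)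
        = State (b + size q + 3) r' M',
      sim (iter i (den c) s) r' M', forall g, g < f -> r' (treg g) = r (treg g)
    & r' (treg f) = m - i].
  elim=> [|i IH] im.
    exists r1, M, 0; split=> //.
    - exact: sim_keeps f3 kk hs.
    - by move=> g gf; rewrite (proj2 kk).
    - by rewrite /= eqxx subn0.
  have [r2 [M2 [u [l2 i2 s2 p2 e2]]]] := IH (ltnW im).
  rewrite -addn2 in k3.
  have [r3 [M3 [v [l3 i3 s3 p3]]]] := h i im P f.+1 _ r2 M2 (leqW f3) k3 s2.
  have [_ [_ w1 _] _ _] := s3.
  have kk3 := keeps_set r3 (r3 (treg f) - r3 (treg 1)) (leqnn f).
  exists [eta r3 with treg f |-> r3 (treg f) - r3 (treg 1)], M3, (1 + (v + (1 + u))).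
  have a1 : b.+2 + size q = b + 2 + size q by lia.
  have a2 : b + size q + 3 = (b + 2 + size q).+1 by lia.
  have a3 : (b.+2 + size q).+1 = b + size q + 3 by lia.
  rewrite -/q in i3; rewrite a1 in k4; rewrite a3 in k5.
  split.
  - by rewrite mulSn; lia.
  - rewrite iterD iterD iterD i2 /= (step_at _ _ k5) /= e2 subn_gt0 im i3.
    by rewrite (step_at _ _ k4) /= a2.
  - exact: sim_keeps f3 kk3 s3.
  - by move=> g gf; rewrite (proj2 kk3) // p3 ?p2 // ltnW.
  - by rewrite /= eqxx p3 // e2 w1; lia.
have [r2 [M2 [u [l2 i2 s2 p2 e2]]]] := main m (leqnn m).
exists r2, M2, (1 + (u + 2)); split=> //.
  have : m * (t + 2) <= n * (t + 2) by rewrite leq_mul2r xn orbT.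
  lia.
have a3 : (b.+2 + size q).+1 = b + size q + 3 by lia.
rewrite a3 in k5.
rewrite iterD iterD init i2 /= (step_at _ _ k5) /= e2 subnn.
by congr State; lia.
Qed.

(* Loop bounds are variables that the loop body does not change, so the running
   time is bounded syntactically. *)
Fixpoint csize (c : cmd) : nat :=
  match c with
  | Asg _ e => (size (comp_expr e 0)).+1
  | Wr a e1 e2 => time_wr a e1 e2
  | Seq c1 c2 => csize c1 + csize c2
  | When e c => size (comp_expr e 0) + csize c + 2
  | Loop _ c => csize c + 3
  end.

Fixpoint depth (c : cmd) : nat :=
  match c with
  | Asg _ _ | Wr _ _ _ => 0
  | Seq c1 c2 => maxn (depth c1) (depth c2)
  | When _ c => depth c
  | Loop _ c => (depth c).+1
  end.

(** [V] contains the loop bounds, and [c] writes to none of them, so the bound [n] is still valid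
    when an inner loop starts. Each loop multiplies the time by at most [n.+1]; the 3 added in
    [csize] pays for its jumps and its counter. *)
Lemma runs_in_bound (V : pred nat) n c s :
  all (predC V) (wvars c) -> all V (lvars c) -> (forall x, V x -> var s x <= n) ->
  runs_in c s (csize c * n.+1 ^ depth c).
Proof.
elim: c s => [x e|a e1 e2|c1 IH1 c2 IH2|e c IH|x c IH] s /=.
- by move=> _ _ _; rewrite muln1; exact: runs_in_asg.
- by move=> _ _ _; rewrite muln1; exact: runs_in_wr.
- rewrite !all_cat => /andP[a1 a2] /andP[l1 l2] hV.
  have g1 := IH1 s a1 l1 hV.
  have g2 : runs_in c2 (den c1 s) (csize c2 * n.+1 ^ depth c2).
    apply: IH2 => // x Vx; rewrite var_frame ?hV //.
    by apply/negP => /(allP a1) /=; rewrite Vx.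
  apply: runs_in_le (runs_in_seq g1 g2).
  by rewrite mulnDl leq_add // leq_mul2l leq_pexp2l ?leq_maxl ?leq_maxr ?orbT.
- move=> a1 l1 hV; apply: runs_in_le (runs_in_when (IH s a1 l1 hV)).
  rewrite !mulnDl; have : 0 < n.+1 ^ depth c by rewrite expn_gt0.
  by set u := _ ^ _; set v := size _; nia.
- move=> a1 /andP[Vx l1] hV.
  have h : forall i, i < var s x ->
     runs_in c (iter i (den c) s) (csize c * n.+1 ^ depth c).
    move=> i _; apply: IH => // y Vy.
    suff -> : var (iter i (den c) s) y = var s y by exact: hV.
    elim: i => //= i <-; rewrite var_frame //.
    by apply/negP => /(allP a1) /=; rewrite Vy.
  apply: runs_in_le (runs_in_loop (hV x Vx) h).
  rewrite expnS; have : 0 < n.+1 ^ depth c by rewrite expn_gt0.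
  by set u := _ ^ _; nia.
Qed.

Definition store0 : store := Store [eta (fun=> 0) with 0 |-> size w] (fun _ _ => 0).

End Semantics.

(** Register 0 is also variable 0, which finally carries the answer, so the input length is first
    copied to its private register. *)
Definition compile (c : cmd) : program :=
  [:: SetConst (treg 1) 1; SetAdd (treg 0) (vreg 0) (treg 2)] ++ comp c 3 2.

(** The 2 counts the prologue. A halted state is a fixed point, so the output stands at every later
    time [u]. *)
Lemma compileP w c t b :
  runs_in w c (store0 w) t -> var (den w c (store0 w)) 0 = nat_of_bool b ->
  forall u, t + 2 <= u -> outputs_within (compile c) w b u.
Proof.
move=> h hb u tu.
have ca : code_at (compile c) 0 (compile c) by exists [::], [::]; rewrite cats0.
have [/code_at_cons[c1 c2] c3] := code_at_cat ca.
set r1 := [eta (register (init w)) with treg 1 |-> 1].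
set r2 := [eta r1 with treg 0 |-> size w].
have i1 : iter 2 (step (compile c)) (init w) = State 2 r2 (nth 0 w).
  by rewrite /= (step_at _ _ c1) /= (step_at _ _ c2) /= addn0.
have s1 : sim w (store0 w) r2 (nth 0 w).
  split=> //.
    move=> x; rewrite /r2 /r1 /= !vtreg /= /vreg.
    by case: x.
  by move=> a i; rewrite nth_default // leq_addr.
have [r' [M' [v [l2 i2 [s2 _ _ _] _]]]] := h (compile c) 3 2 _ _ (leqnn 3) c3 s1.
have hh : halted (compile c) (State (2 + size (comp c 3 2)) r' M').
  by rewrite /halted /compile size_cat.
have -> : u = (u - (v + 2)) + (v + 2) by lia.
rewrite /outputs_within iterD iterD i1 i2.
set st := State _ _ _ in hh *.
have -> : forall m, iter m (step (compile c)) st = st.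
  by elim=> //= m ->; rewrite /step (onth_default hh).
by split=> //=; rewrite -hb -s2.
Qed.

(** * Candidate assignments to the universal variables *)

Lemma mem_rconsW (T : eqType) (x y : T) s : x \in s -> x \in rcons s y.
Proof. by rewrite mem_rcons inE orbC => ->. Qed.

Lemma ltn_sub_count (T : eqType) (a b : pred T) s x :
  {subset a <= b} -> x \in s -> b x -> ~~ a x -> count a s < count b s.
Proof.
move=> ab; elim: s => //= y s IH; rewrite inE => /orP[/eqP <- bx nx|xs bx nx].
  by rewrite bx (negbTE nx) ltnS; apply: sub_count => z; exact: ab.
rewrite -addnS leq_add ?IH //.
by have := ab y; rewrite /in_mem /=; case: (a y) => // ->.
Qed.

Section Candidates.
Variables (n k : nat) (cs : seq (clause n k)).

(* A partial assignment sends i to 0 if y_i is unassigned, to 1 if y_i is false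
   and to a larger number if y_i is true. *)
Implicit Type sg : nat -> nat.

Definition lit_open (G : seq nat) sg (l : literal n k) : bool :=
  match l.2 with
  | inl i => sg i != l.1.+1
  | inr j => (j.*2 + l.1) \in G
  end.

Definition clash (l l' : literal n k) : bool :=
  match l.2, l'.2 with
  | inl i, inl i' => (i == i' :> nat) && (l.1 != l'.1)
  | _, _ => false
  end.

(** A clause with complementary universal literals is true for every y and can never be
    falsified. *)
Definition consistent (C : clause n k) : bool :=
  all (fun l => all (fun l' => ~~ clash l l') C) C.

(** A clause whose existential literals form only a part of [G] counts for [G] too: once its
    universal part is false, it is false under every x that falsifies all literals in [G]. *)
Definition cl_open G sg C : bool := all (lit_open G sg) C && consistent C.

Definition free_var sg (l : literal n k) : option nat :=
  if l.2 is inl i then if sg i == 0 then Some (nat_of_ord i) else None else None.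

Definition free_vars sg (C : clause n k) : seq nat := pmap (free_var sg) C.

Definition hit_step G sg (H : seq nat) C : seq nat :=
  if cl_open G sg C && ~~ has (mem H) (free_vars sg C)
  then H ++ free_vars sg C else H.

Definition hitting G sg : seq nat := foldl (hit_step G sg) [::] cs.

(** A position past the end of [H] is ignored, so every sequence of digits describes a candidate. *)
Definition assign (H : seq nat) sg (p b : nat) : nat -> nat :=
  if p < size H then upd sg (nth 0 H p) b.+1 else sg.

(* D lists the d - 1 literals of a group, with code 2 j + s for (s, x_j), then d
   positions in the hitting set, then d values. *)
Definition guided_step d sg (D : seq nat) : nat -> nat :=
  let H := hitting (take d.-1 D) sg in
  foldl (fun sg' i => assign H sg' (nth 0 D (d.-1 + i)) (nth 0 D (d.-1 + d + i)))
    sg (iota 0 d).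

Definition run d sg (bl : seq (seq nat)) : nat -> nat := foldl (guided_step d) sg bl.

Definition total sg : {ffun 'I_n -> bool} := [ffun i : 'I_n => 1 < sg i].

Lemma free_varsP sg (C : clause n k) (v : nat) :
  reflect (exists l i, [/\ l \in C, l.2 = inl i, v = val i & sg i = 0])
          (v \in free_vars sg C).
Proof.
rewrite mem_pmap; apply: (iffP mapP) => [[l lC]|[l [i [lC li -> si]]]].
  rewrite /free_var; case E: l.2 => [i|//]; case: eqP => // si [->].
  by exists l, i.
by exists l => //; rewrite /free_var li [sg _]si.
Qed.

Lemma size_free_vars sg (C : clause n k) : size (free_vars sg C) <= size C.
Proof. by rewrite size_pmap count_size. Qed.

(** * Greedy families of disjoint clauses *)

Section Hitting.
Variables (G : seq nat) (sg : nat -> nat) (d : nat).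
Hypothesis size_cs : {in cs, forall C, size C <= d}.

Lemma hitting_unset v : v \in hitting G sg -> v < n /\ sg v = 0.
Proof.
rewrite /hitting; elim/last_ind: cs => //= s C IH.
rewrite foldl_rcons {1}/hit_step; case: ifP => // _; rewrite mem_cat => /orP[//|].
by case/free_varsP => l [i [_ _ -> si]]; split; [exact: ltn_ord|exact: si].
Qed.

(** The greedy family is maximal: an open clause that did not meet the list when its turn came was
    added to it. *)
Lemma hitting_hits C :
  C \in cs -> cl_open G sg C -> free_vars sg C != [::] ->
  exists2 v, v \in hitting G sg & v \in free_vars sg C.
Proof.
rewrite /hitting; elim/last_ind: cs => //= s C' IH.
rewrite mem_rcons inE foldl_rcons; set H := foldl _ _ _ in IH *.
case/orP=> [/eqP ->|Cs] oC vC; last first.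
  have [v vH vv] := IH Cs oC vC; exists v => //.
  by rewrite /hit_step; case: ifP => // _; rewrite mem_cat vH.
rewrite /hit_step oC /=; case: hasPn => /= h.
  case E: (free_vars sg C') vC => [//|v r] _; exists v; rewrite ?mem_cat inE eqxx ?orbT //.
have /hasP[v vv vH] : has (mem H) (free_vars sg C').
  by apply/negPn/negP => /hasPn.
by exists v.
Qed.

(** The first open clause meets an empty list and is always taken, so its unassigned variables stand
    at the front. Hence the positions below [d] are enough to falsify a whole clause in one step. *)
Lemma hitting_first :
  has (cl_open G sg) cs ->
  exists C, [/\ C \in cs, cl_open G sg C &
                {subset free_vars sg C <= take d (hitting G sg)}].
Proof.
rewrite /hitting; move: size_cs; elim/last_ind: cs => //= s C IH sz.
have {}IH := IH (fun D h => sz D (mem_rconsW _ h)).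
rewrite has_rcons foldl_rcons; set H := foldl _ _ _ in IH *.
case: (boolP (has _ s)) => [hs _|hs].
  have [D [Ds oD sD]] := IH hs; exists D; split=> //.
    by rewrite mem_rcons inE Ds orbT.
  move=> v /sD; rewrite /hit_step; case: ifP => // _.
  by rewrite take_cat; case: ltnP => // h; rewrite take_oversize // mem_cat => ->.
rewrite orbF => oC; exists C; split=> //; first by rewrite mem_rcons inE eqxx.
(* No earlier clause is open, so nothing has been collected yet. *)
have -> : H = [::].
  rewrite /H; move: hs; elim/last_ind: (s) => //= s' D IH'.
  rewrite has_rcons negb_or foldl_rcons => /andP[nD /IH' ->].
  by rewrite /hit_step (negbTE nD).
rewrite /hit_step oC /=; case: hasP => [[]//|_] /=.
rewrite take_oversize //; apply: leq_trans (size_free_vars _ _) (sz _ _).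
by rewrite mem_rcons inE eqxx.
Qed.

(** The chosen clauses have disjoint unassigned variables and each contains an element of [U], so
    there are at most [#|U|] of them, and each adds at most [d] entries. The induction counts the
    elements of [U] met so far. *)
Lemma hitting_small (U : {set 'I_n}) :
  {in cs, forall C, cl_open G sg C -> exists2 i, i \in U & val i \in free_vars sg C} ->
  size (hitting G sg) <= d * #|U|.
Proof.
move=> hU.
suff : size (hitting G sg) <= d * #|[set i in U | val i \in hitting G sg]|.
  move=> h; apply: leq_trans h _; rewrite leq_mul2l subset_leq_card ?orbT //.
  by apply/subsetP => i; rewrite inE => /andP[].
rewrite /hitting; move: hU size_cs; elim/last_ind: cs => //= s C IH hU sz.
have {}IH := IH (fun D h => hU D (mem_rconsW _ h)) (fun D h => sz D (mem_rconsW _ h)).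
rewrite foldl_rcons; set H := foldl _ _ _ in IH *.
rewrite /hit_step; case: ifP => [/andP[oC dj]|//].
have CC : C \in rcons s C by rewrite mem_rcons inE eqxx.
have [i iU iC] := hU C CC oC.
rewrite size_cat; set V := [set _ in _ | _] in IH.
set V' := [set _ in _ | _].
have iV : i \notin V.
  by rewrite inE iU /=; apply/negP => iH; move/hasPn: dj => /(_ _ iC) /=; rewrite iH.
have : #|i |: V| <= #|V'|.
  apply/subset_leq_card/subsetP => j; rewrite !inE => /orP[/eqP ->|/andP[-> h]].
    by rewrite iU mem_cat iC orbT.
  by rewrite mem_cat h.
rewrite cardsU1 iV /= => hV.
have := leq_trans (size_free_vars sg C) (sz _ CC).
have : d * (1 + #|V|) <= d * #|V'| by rewrite leq_mul2l hV orbT.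
by rewrite mulnDr muln1 => a b; apply: leq_trans a; rewrite addnC leq_add.
Qed.

End Hitting.

(** The values are a function [f] of the variable, so repeated positions agree and the order of the
    assignments has no effect. *)
Lemma guided_stepP d sg G ps (f : nat -> bool) :
  size G = d.-1 -> size ps = d ->
  let H := hitting G sg in
  forall v, guided_step d sg
      (G ++ ps ++ [seq nat_of_bool (f (nth 0 H p)) | p <- ps]) v =
    if v \in [seq nth 0 H p | p <- ps & p < size H] then (f v).+1 else sg v.
Proof.
move=> sG sp H; rewrite /guided_step take_size_cat // -/H.
set D := G ++ _; set F := fun _ _ => _.
have DF sg' i : i < d -> F sg' i = assign H sg' (nth 0 ps i) (f (nth 0 H (nth 0 ps i))).
  move=> id; rewrite /F /D -sG !nth_cat ltnNge leq_addr /= addKn sp id.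
  rewrite -addnA ltnNge leq_addr /= addKn ltnNge leq_addr /= addKn.
  by rewrite (nth_map 0) ?sp.
suff h m : m <= d -> forall v, foldl F sg (iota 0 m) v =
    if v \in [seq nth 0 H p | p <- take m ps & p < size H] then (f v).+1 else sg v.
  by move=> v; rewrite h // take_oversize ?sp.
elim: m => [|m IH] md v; first by rewrite take0.
rewrite -addn1 iotaD foldl_cat /= add0n DF // addn1 (take_nth 0) ?sp //.
rewrite -cats1 filter_cat map_cat mem_cat /= /assign; case: ifP => h /=.
  rewrite /upd inE; case: eqP => [->|_]; first by rewrite orbT.
  by rewrite orbF IH // ltnW.
by rewrite orbF IH // ltnW.
Qed.

Lemma hitting_ext G sg sg' : (forall v, v < n -> sg v = sg' v) ->
  hitting G sg = hitting G sg'.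
Proof.
move=> h; rewrite /hitting; elim: cs [::] => //= C r IH H; rewrite IH.
congr (foldl _ _ _).
have fE : free_vars sg C = free_vars sg' C.
  by apply: eq_pmap => l; rewrite /free_var; case: l.2 => // i; rewrite h.
rewrite /hit_step /cl_open fE; congr (if (_ && _) && _ then _ else _).
by apply: eq_all => l; rewrite /lit_open; case: l.2 => // i; rewrite h.
Qed.

(** Before each candidate the machine clears only the cells below [n]; the result must not depend on
    the others. *)
Lemma run_ext d sg sg' bl : (forall v, v < n -> sg v = sg' v) ->
  total (run d sg bl) = total (run d sg' bl).
Proof.
move=> h; apply/ffunP => i; rewrite !ffunE; congr (_ < _).
elim: bl sg sg' h (val i) (ltn_ord i) => [|D bl IH] sg sg' h v vn; first exact: h.
rewrite /run /=; apply: IH vn => u un; rewrite /guided_step (hitting_ext _ h).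
move: (hitting _ sg') => H.
elim: (iota 0 d) sg sg' h => [|j r IHr] sg sg' h /=; first exact: h.
by apply: IHr => t tn; rewrite /assign; case: ifP => _; rewrite /upd h.
Qed.

Definition extends sg tau := forall v, sg v != 0 -> tau v = sg v.

Definition support sg : {set 'I_n} := [set i : 'I_n | sg i != 0].

Lemma extends_trans s1 s2 s3 : extends s1 s2 -> extends s2 s3 -> extends s1 s3.
Proof. by move=> h1 h2 v hv; rewrite h2 h1. Qed.

(** * Some candidate falsifies the formula whenever [ystar] does *)

Section Completeness.
Variables (d : nat) (ystar : {ffun 'I_n -> bool}).
Hypothesis d_gt1 : 1 < d.
Hypothesis size_cs : {in cs, forall C, size C <= d}.
Hypothesis falsifies : forall x, ~~ cnf_val cs ystar x.

(** There are [N] groups. Each is visited [d] times in the first phase and once in the second, and a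
    visit fixes at most [d] variables, which gives [D]. A list longer than [B] belongs to a family
    that [D] variables cannot meet entirely. *)
Let N := (2 * k + 1) ^ d.-1.
Let D := d * (d.+1 * N).
Let B := d * D.

Definition target (G : seq nat) (C : clause n k) : bool :=
  (C \in cs) && all (fun l : literal n k => match l.2 with
     | inl i => l.1 != ystar i | inr j => j.*2 + l.1 \in G end) C.

(* G stays satisfiable: whatever the other groups commit to, some clause of G can
   still be falsified. *)
Definition safe G sg : Prop :=
  forall tau, extends sg tau -> #|support tau| <= D -> has (cl_open G tau) cs.

(** An invariant of the first phase, where variables are only fixed as in [ystar]; the second phase
    gives it up. *)
Definition compatible sg : Prop := forall v, sg v = 0 \/ exists i : 'I_n,
  v = i :> nat /\ sg v = (ystar i).+1.

Lemma safe_extends G sg tau : extends sg tau -> safe G sg -> safe G tau.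
Proof. by move=> e s rho e'; apply: s; exact: extends_trans e'. Qed.

Lemma target_open G sg C : compatible sg -> target G C -> cl_open G sg C.
Proof.
move=> c /andP[_ tC]; apply/andP; split.
  apply/allP => l lC; have := allP tC _ lC; rewrite /lit_open.
  case: l.2 => // i; case: (c i) => [->//|[i' [/ord_inj <- ->]]].
  by rewrite eqSS; case: l.1; case: (ystar i).
(* Two clashing literals cannot both be false under [ystar]. *)
apply/allP => l lC; apply/allP => l' lC'; have := allP tC _ lC; have := allP tC _ lC'.
rewrite /clash; case: l.2 => // i; case: l'.2 => // i'.
case: (@eqP _ (i : nat)) => //= /ord_inj <-; by case: l.1; case: l'.1; case: (ystar i).
Qed.

(** With no unassigned variable left, the universal part of [C] is already false and stays so in
    every extension. *)
Lemma target_safe G sg C :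
  compatible sg -> target G C -> free_vars sg C = [::] -> safe G sg.
Proof.
move=> c tC v0 tau e _; apply/hasP; exists C; first by case/andP: tC.
have /andP[o1 o2] := target_open c tC; rewrite /cl_open o2 andbT.
apply/allP => l lC; have := allP o1 _ lC; rewrite /lit_open.
case E: l.2 => [i|//]; rewrite -e //; apply/negP => /eqP si.
have : val i \in free_vars sg C by apply/free_varsP; exists l, i.
by rewrite v0.
Qed.

(** If [tau] left no open clause for [G], every clause open under [sg] would contain a variable
    newly fixed by [tau]. At most [D] variables would then meet all of them, and [hitting_small]
    would bound the list by [B]. *)
Lemma large_safe G sg : B < size (hitting G sg) -> safe G sg.
Proof.
move=> h tau e sD; apply/negPn/negP => /hasPn no.
move: h; apply/negP; rewrite -leqNgt.
apply: leq_trans (leq_mul (leqnn d) sD).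
apply: hitting_small => // C Cs /andP[o1 o2].
have := no C Cs; rewrite /cl_open o2 andbT => /allPn[l lC].
have := allP o1 _ lC; rewrite /lit_open; case E: l.2 => [i|]; last by move=> ->.
move=> h1 h2; exists i.
  by rewrite inE; move: h2; rewrite negbK => /eqP ->.
apply/free_varsP; exists l, i; split=> //; apply/eqP/negPn/negP => si.
by move: h2; rewrite (e _ si) h1.
Qed.

Definition good_block (bl : seq nat) : bool :=
  (size bl == d.-1 + d + d) && all (fun a => a < B) bl.

(** Codes of literals are below [2 * k]; the code [2 * k] itself pads groups with fewer literals. *)
Definition good_group (G : seq nat) : bool :=
  (size G == d.-1) && all (fun a => a < 2 * k + 1) G.

Lemma leq_groups : 2 * k + 1 <= N.
Proof. by rewrite /N -{1}(expn1 (2 * k + 1)) leq_pexp2l //; lia. Qed.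

Lemma ltn_d_B : d < B.
Proof.
have := leq_groups; rewrite /B /D => h.
have : 0 < N by lia.
by case: (d) d_gt1 => // d' _ N0; nia.
Qed.

Lemma B_gt0 : 0 < B.
Proof. exact: ltn_trans (ltnW d_gt1) ltn_d_B. Qed.

Lemma leq_groups_B : 2 * k + 1 <= B.
Proof.
have := leq_groups; rewrite /B /D => h.
by case: (d) d_gt1 => // d' _; nia.
Qed.

(** The list holds only unassigned variables, so a step overwrites nothing and yields an
    extension. *)
Lemma step_block G sg ps (f : nat -> bool) :
  good_group G -> size ps = d -> all (fun p => p < B) ps ->
  exists bl, let tau := guided_step d sg bl in
  [/\ good_block bl, extends sg tau, #|support tau| <= #|support sg| + d &
      forall v, tau v =
        if v \in [seq nth 0 (hitting G sg) p | p <- ps & p < size (hitting G sg)]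
        then (f v).+1 else sg v].
Proof.
move=> /andP[/eqP sG aG] sps aps.
exists (G ++ ps ++ [seq nat_of_bool (f (nth 0 (hitting G sg) p)) | p <- ps]).
move=> tau; have tauE v : tau v = _ := guided_stepP sg f sG sps v; split=> //.
- apply/andP; split; first by rewrite !size_cat size_map sG sps addnA.
  rewrite !all_cat aps /=; apply/andP; split.
    by apply: sub_all aG => a h; apply: leq_trans leq_groups_B.
  rewrite all_map; apply/allP => p _ /=; apply: leq_ltn_trans (leq_b1 _) _.
  exact: ltn_trans ltn_d_B.
- move=> v sv; rewrite tauE; case: ifP => // /mapP[p].
  rewrite mem_filter => /andP[ph _] ve.
  have := @hitting_unset G sg v; rewrite ve mem_nth // => /(_ isT)[_ h].
  by move: sv; rewrite ve h.
- set s := [seq nth 0 (hitting G sg) p | p <- ps & p < size (hitting G sg)] in tauE.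
  have ss : size s <= d by rewrite size_map size_filter -sps count_size.
  have sub : support tau \subset support sg :|: [set i : 'I_n | val i \in s].
    by apply/subsetP => i; rewrite !inE tauE; case: ifP => _; rewrite ?orbT // => ->.
  apply: leq_trans (subset_leq_card sub) _; rewrite cardsU.
  apply: leq_trans (leq_subr _ _) _; rewrite leq_add2l; apply: leq_trans ss.
  rewrite cardsE; set A := mem _.
  have -> : #|A| = size [seq val i | i <- enum A] by rewrite size_map cardE.
  apply: uniq_leq_size; first by rewrite map_inj_uniq ?enum_uniq //; exact: val_inj.
  by move=> v /mapP[i]; rewrite mem_enum => h ->.
Qed.

(** [r] bounds the unassigned literals left in [C]. A block is needed even if [C] is no target,
    since every group has its place in a fixed schedule; progress is claimed for a target only. *)
Lemma visit G C r sg :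
  good_group G -> compatible sg ->
  exists bl, let tau := guided_step d sg bl in
  [/\ good_block bl, extends sg tau, #|support tau| <= #|support sg| + d,
      compatible tau &
      target G C -> safe G sg \/ size (free_vars sg C) <= r.+1 ->
      safe G tau \/ size (free_vars tau C) <= r].
Proof.
move=> gG cs0; set H := hitting G sg.
pose f v := if insub v is Some i then ystar i else false.
have fE (i : 'I_n) : f i = ystar i by rewrite /f valK.
have compat : forall ps tau, (forall v, tau v =
        if v \in [seq nth 0 H p | p <- ps & p < size H]
        then (f v).+1 else sg v) -> compatible tau.
  move=> ps tau tauE v; rewrite tauE; case: ifP => [/mapP[p]|_]; last exact: cs0.
  rewrite mem_filter => /andP[ph _] ->; right.
  have [lt _] := @hitting_unset G sg (nth 0 H p) (mem_nth 0 ph).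
  by exists (Ordinal lt); split=> //; rewrite -(fE (Ordinal lt)).
(* Position 0 is a dummy for a large list, for a [C] that is no target, and for a [C] without
   unassigned variables. Otherwise [p] is a place where the list meets [C]. *)
have [p pB pP] : exists2 p, p < B & target G C -> safe G sg \/
    free_vars sg C = [::] \/ (p < size H /\ nth 0 H p \in free_vars sg C).
  case: (leqP (size H) B) => sH; last first.
    exists 0; first exact: B_gt0.
    by left; apply: large_safe.
  case: (boolP (target G C)) => tC; last first.
    by exists 0 => //; exact: B_gt0.
  case: (altP (free_vars sg C =P [::])) => v0.
    by exists 0; [exact: B_gt0|right; left].
  have [v vH vC] := hitting_hits (proj1 (andP tC)) (target_open cs0 tC) v0.
  exists (index v H); first by rewrite (leq_trans _ sH) // index_mem.
  by move=> _; right; right; rewrite index_mem nth_index.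
(* All [d] positions of the block are [p], so this step fixes at most one variable. *)
have [||bl [h1 h2 h3 h4]] := @step_block G sg (nseq d p) f gG.
- by rewrite size_nseq.
- by rewrite all_nseq pB orbT.
exists bl => tau; split=> //; first exact: compat h4.
move=> tC; case=> [s|sz]; first by left; exact: safe_extends s.
have [s|[v0|[pH pC]]] := pP tC; first by left; exact: safe_extends s.
  by left; apply: safe_extends h2 _; exact: target_safe v0.
right; rewrite -ltnS; apply: leq_trans sz.
move: pC; set u := nth 0 H p => uC.
have tu : tau u != 0.
  rewrite [tau _]h4 -/H; case: mapP => // -[]; exists p => //.
  by rewrite mem_filter pH mem_nseq eqxx andbT; lia.
case/free_varsP: (uC) => l [i [lC li ui si]].
rewrite !size_pmap; apply: (@ltn_sub_count _ _ _ _ l) => //.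
- move=> l'; rewrite /in_mem /= /free_var; case: l'.2 => // i'.
  case: eqP => // t0 _; case: eqP => // /eqP s0.
  by move: (s0); rewrite -(h2 _ s0) [guided_step _ _ _ _]t0.
- by rewrite /free_var li [sg _]si.
- by rewrite /free_var li; move: tu; rewrite ui; case: eqP.
Qed.

Definition good_blocks r (bl : seq (seq nat)) := (size bl == r) && all good_block bl.

Lemma visits G C r sg :
  good_group G -> compatible sg ->
  (target G C -> safe G sg \/ size (free_vars sg C) <= r) ->
  exists bl, let tau := run d sg bl in
  [/\ good_blocks r bl,
      extends sg tau, #|support tau| <= #|support sg| + d * r,
      compatible tau & target G C -> safe G tau].
Proof.
move=> gG; elim: r sg => [|r IH] sg csg h.
  exists [::]; split=> //; first by rewrite muln0 addn0.
  move=> tC; have [//|] := h tC; rewrite leqn0 => /nilP v0.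
  exact: target_safe v0.
have [b [g1 e1 u1 c1 s1]] := visit C r gG csg.
have [bl [/andP[z2 g2] e2 u2 c2 s2]] := IH _ c1 (fun tC => s1 tC (h tC)).
exists (b :: bl); split=> //=.
- by rewrite /good_blocks /= g1 eqSS z2.
- exact: extends_trans e2.
- by apply: leq_trans u2 _; rewrite mulnS addnA leq_add2r.
Qed.

(** A target has at most [d] literals, so [d] rounds use up its unassigned variables or make the
    group safe earlier. Safety passes to extensions and survives the visits to later groups. *)
Lemma phase1 gs sg :
  all good_group gs -> compatible sg ->
  exists bl, let tau := run d sg bl in
  [/\ good_blocks (d * size gs) bl, extends sg tau,
      #|support tau| <= #|support sg| + d * (d * size gs),
      compatible tau & {in gs, forall G, has (target G) cs -> safe G tau}].
Proof.
elim: gs sg => [|G gs IH] sg /= => [_ csg|/andP[gG ggs] csg].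
  by exists [::]; split=> //=; rewrite ?muln0 ?addn0.
(* If [G] has no target, this is the default [[::]], about which nothing is claimed. *)
pose C := nth [::] cs (find (target G) cs).
have [|bl1 [/andP[/eqP z1 g1] e1 u1 c1 s1]] := @visits G C d sg gG csg.
  move=> /andP[Cs _]; right; apply: leq_trans (size_free_vars _ _) (size_cs Cs).
have [bl2 [/andP[/eqP z2 g2] e2 u2 c2 s2]] := IH _ ggs c1.
exists (bl1 ++ bl2); rewrite /run foldl_cat -!/(run _ _ _); split=> //.
- by rewrite /good_blocks size_cat all_cat g1 g2 z1 z2 mulnS eqxx.
- exact: extends_trans e2.
- by apply: leq_trans u2 _; rewrite mulnS mulnDr addnA leq_add2r.
- move=> G'; rewrite inE => /orP[/eqP ->|/s2 //] hG.
  by apply: safe_extends e2 (s1 _); exact: nth_find.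
Qed.

Definition done (G : seq nat) sg : bool :=
  has (all (fun l : literal n k => match l.2 with
    | inl i => sg i == (~~ l.1).+1 | inr j => j.*2 + l.1 \in G end)) cs.

Lemma done_extends G sg tau : extends sg tau -> done G sg -> done G tau.
Proof.
move=> e; apply: sub_has => C; apply: sub_all => l.
by case: l.2 => // i /eqP h; rewrite e h.
Qed.

(** The open clause found here may differ from the one that [ystar] falsifies, so values are chosen
    against this clause. The bound 2 replaces compatibility: an assigned variable that does not
    satisfy a literal then falsifies it. *)
Lemma commit G sg :
  good_group G -> (forall v, sg v <= 2) ->
  exists bl, let tau := guided_step d sg bl in
  [/\ good_block bl, extends sg tau, #|support tau| <= #|support sg| + d,
      forall v, tau v <= 2 & has (cl_open G sg) cs -> done G tau].
Proof.
move=> gG sg2; set H := hitting G sg.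
have [C hC] : exists C, has (cl_open G sg) cs -> [/\ C \in cs, cl_open G sg C &
                {subset free_vars sg C <= take d H}].
  case: (boolP (has _ _)) => h; last by exists [::].
  by have [C hC] := hitting_first size_cs h; exists C.
(* A variable becomes false if it occurs positively in [C], and true otherwise; as [C] is
   consistent, this falsifies its unassigned literals. *)
pose f v := ~~ has (fun l : literal n k => l.1 &&
   (if l.2 is inl i then i == v :> nat else false)) C.
have [||bl [h1 h2 h3 h4]] := @step_block G sg (iota 0 d) f gG.
- by rewrite size_iota.
- apply/allP => p; rewrite mem_iota => /andP[_ h].
  by apply: ltn_trans ltn_d_B; rewrite add0n in h.
exists bl => tau; have tauE v : tau v = _ := h4 v; split=> //.
  by move=> v; rewrite tauE; case: ifP => // _; case: (f v).
move=> h; have [Cs /andP[oC kC] sub] := hC h.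
apply/hasP; exists C => //; apply/allP => l lC; have := allP oC _ lC.
rewrite /lit_open; case E: l.2 => [i|//] si.
case: (boolP (sg i == 0)) => [/eqP s0|s0]; last first.
  rewrite [tau _](h2 _ s0); have := sg2 i; move: s0 si.
  by case: l.1; case: (sg i) => [|[|[|]]].
have : val i \in take d H by apply: sub; apply/free_varsP; exists l, i.
move=> iH; rewrite tauE -/H; case: mapP => [_|[]]; last first.
  exists (index (val i) (take d H)).
    have ix := iH; rewrite -index_mem in ix; move: (ix); rewrite size_take_min => ix'.
    rewrite mem_filter mem_iota /= add0n; apply/andP; split.
      by apply: leq_trans ix' _; exact: geq_minr.
    by apply: leq_trans ix' _; exact: geq_minl.
  rewrite -(nth_take 0 (n0 := d)) ?nth_index //.
  by rewrite -index_mem size_take_min in iH; apply: leq_trans iH (geq_minl _ _).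
rewrite eqSS /f; case El: l.1 => /=.
  suff -> : has (fun l' : literal n k => l'.1 && (if l'.2 is inl i' then i' == i :> nat else false)) C by [].
  by apply/hasP; exists l => //; rewrite El E eqxx.
case: hasP => // -[l' lC' /andP[El' h']]; exfalso.
have := allP (allP kC _ lC) _ lC'; rewrite /clash E.
by move: h'; case: l'.2 => // i' /eqP ->; rewrite eqxx El El'.
Qed.

(** The variables fixed so far, plus [d] for each pending group, number at most [D]; so a safe group
    still has an open clause when its turn comes. *)
Lemma phase2 gs sg :
  all good_group gs -> (forall v, sg v <= 2) ->
  #|support sg| + d * size gs <= D ->
  {in gs, forall G, has (target G) cs -> safe G sg} ->
  exists bl, let tau := run d sg bl in
  [/\ good_blocks (size gs) bl, extends sg tau
    & {in gs, forall G, has (target G) cs -> done G tau}].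
Proof.
elim: gs sg => [|G gs IH] sg /= => [_ sg2 _ _|/andP[gG ggs] sg2 uD sf].
  by exists [::].
have [b [g1 e1 u1 r1 d1]] := commit gG sg2.
have [||bl [/andP[z2 g2] e2 d2]] := IH _ ggs r1.
- by apply: leq_trans uD; rewrite mulnS addnA leq_add2r.
- by move=> G' G's hG; apply: safe_extends e1 (sf _ _ hG); rewrite inE G's orbT.
exists (b :: bl); split=> //=.
- by rewrite /good_blocks /= g1 eqSS z2.
- exact: extends_trans e2.
- move=> G'; rewrite inE => /orP[/eqP ->|/d2 //] hG.
  apply: done_extends e2 (d1 _); apply: sf => //; first by rewrite inE eqxx.
  by apply: leq_trans uD; exact: leq_addr.
Qed.

Definition groups : seq (seq nat) :=
  [seq map val (tval t) | t <- enum {: d.-1.-tuple 'I_(2 * k + 1)}].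

Lemma size_groups : size groups = N.
Proof. by rewrite size_map -cardE card_tuple card_ord. Qed.

Lemma good_groups : all good_group groups.
Proof.
apply/allP => G /mapP[t _ ->]; rewrite /good_group size_map size_tuple eqxx /=.
by rewrite all_map; apply/allP => i _ /=.
Qed.

Lemma mem_groups G : good_group G -> G \in groups.
Proof.
move=> /andP[/eqP sG /allP aG]; apply/mapP.
have lt : 0 < 2 * k + 1 by rewrite addn1.
pose t := [seq insubd (Ordinal lt) a | a <- G].
have st : size t == d.-1 by rewrite size_map sG.
exists (Tuple st); rewrite ?mem_enum // /t /= -map_comp -[LHS]map_id.
by apply/eq_in_map => a /aG h; rewrite /= insubdK.
Qed.

Lemma guided_falsifies :
  exists bl, good_blocks (d.+1 * N) bl /\
    forall x, ~~ cnf_val cs (total (run d (fun=> 0) bl)) x.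
Proof.
have c0 : compatible (fun=> 0) by move=> v; left.
have s0 : #|support (fun=> 0)| = 0 by apply: eq_card0 => i; rewrite inE.
have [bl1 [/andP[/eqP z1 g1] e1 u1 c1 s1]] := phase1 good_groups c0.
have r1 v : run d (fun=> 0) bl1 v <= 2.
  by case: (c1 v) => [->//|[i [_ ->]]]; case: (ystar i).
have [|bl2 [/andP[/eqP z2 g2] e2 d2]] := phase2 good_groups r1 _ s1.
  rewrite s0 add0n in u1; rewrite size_groups in u1 *.
  by rewrite /D mulSn mulnDr addnC leq_add2l.
exists (bl1 ++ bl2); split.
  by rewrite /good_blocks all_cat g1 g2 size_cat z1 z2 size_groups mulSn addnC eqxx.
rewrite /run foldl_cat -!/(run _ _ _) => x.
set tau := run d _ _ in d2 *.
have /allPn[C Cs fC] := falsifies x.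
(* A clause without universal literals is false at [x] for every y. Otherwise at most [d.-1] of its
   literals are existential, and they fit into a group. *)
case: (boolP (all (fun l : literal n k => if l.2 is inr _ then true else false) C)) => exC.
  apply/allPn; exists C => //; apply: contra fC => /hasP[l lC h].
  apply/hasP; exists l => //; move: h (allP exC _ lC); rewrite /lit_val.
  by case: l.2.
pose codes := pmap (fun l : literal n k =>
   if l.2 is inr j then Some (j.*2 + l.1) else None) C.
pose G := codes ++ nseq (d.-1 - size codes) (2 * k).
have sc : size codes <= d.-1.
  rewrite -ltnS (ltn_predK d_gt1); apply: leq_trans (size_cs Cs).
  rewrite size_pmap ltn_neqAle count_size andbT -all_count.
  by apply: contra exC; apply: sub_all => l; case: l.2.
have code_lt (l : literal n k) j : l.2 = inr j -> j.*2 + l.1 < 2 * k.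
  by move=> _; have := ltn_ord j; case: l.1 => /=; lia.
have gG : good_group G.
  rewrite /good_group size_cat size_nseq subnKC // eqxx /=.
  rewrite all_cat all_nseq; apply/andP; split; last by rewrite addn1 ltnSn orbT.
  apply/allP => a; rewrite mem_pmap => /mapP[l lC].
  by case E: l.2 => [//|j] [->]; rewrite addn1 ltnS ltnW // code_lt.
have tG : has (target G) cs.
  apply/hasP; exists C => //; rewrite /target Cs /=; apply/allP => l lC.
  have : ~~ lit_val ystar x l by apply: contra fC => h; apply/hasP; exists l.
  rewrite /lit_val; case E: l.2 => [i|j] // _.
  by rewrite mem_cat mem_pmap; apply/orP; left; apply/mapP; exists l; rewrite ?E.
(* The committed clause [C'] has its existential literals among those of [C], which are false at
   [x], and [tau] falsifies its universal literals. *)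
have /hasP[C' Cs' /allP dC] := d2 _ (mem_groups gG) tG.
apply/allPn; exists C' => //; apply/hasPn => l lC.
have := dC _ lC; rewrite /lit_val; case E: l.2 => [i|j].
  by rewrite ffunE => /eqP ->; case: l.1.
rewrite mem_cat mem_nseq => /orP[|/andP[_ /eqP h]]; last first.
  by have := code_lt _ _ E; rewrite h ltnn.
rewrite mem_pmap => /mapP[l' lC'].
case E': l'.2 => [//|j'] [jj].
have [sj jj'] : l.1 = l'.1 /\ j = j'.
  move: jj; case: l.1; case: l'.1 => h; split=> //; try apply: val_inj => /=; lia.
rewrite sj jj'; apply: contra fC => h; apply/hasP; exists l' => //.
by rewrite /lit_val E'.
Qed.

End Completeness.
End Candidates.

(** * The search program *)

Definition tst (w : seq nat) (e : expr) (s : store) : bool := 0 < eval w e s.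

Definition eNot e := Sub (Const 1) e.
Definition eOr e1 e2 := Add e1 e2.
Definition eAnd e1 e2 := eNot (eOr (eNot e1) (eNot e2)).
Definition eLt e1 e2 := Sub e2 e1.
Definition eEq e1 e2 := eNot (Add (Sub e1 e2) (Sub e2 e1)).
(** [d] is a constant of the program, so quantifiers over the literals of a clause are unrolled into
    one expression. *)
Definition eAll (f : nat -> expr) (d : nat) := foldr (fun i => eAnd (f i)) (Const 1) (iota 0 d).
Definition eHas (f : nat -> expr) (d : nat) := foldr (fun i => eOr (f i)) (Const 0) (iota 0 d).
Fixpoint eMul (c : nat) (e : expr) : expr := if c is c'.+1 then Add e (eMul c' e) else Const 0.

(** * Truth values of tests and the invariant rule for loops *)

Section Tests.
Variable w : seq nat.

Lemma tst_not e s : tst w (eNot e) s = ~~ tst w e s.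
Proof. by rewrite /tst /=; lia. Qed.

Lemma tst_or e1 e2 s : tst w (eOr e1 e2) s = tst w e1 s || tst w e2 s.
Proof. by rewrite /tst /= addn_gt0. Qed.

Lemma tst_and e1 e2 s : tst w (eAnd e1 e2) s = tst w e1 s && tst w e2 s.
Proof. by rewrite /eAnd tst_not tst_or !tst_not negb_or !negbK. Qed.

Lemma tst_lt e1 e2 s : tst w (eLt e1 e2) s = (eval w e1 s < eval w e2 s).
Proof. by rewrite /tst /= subn_gt0. Qed.

Lemma tst_eq e1 e2 s : tst w (eEq e1 e2) s = (eval w e1 s == eval w e2 s).
Proof. by rewrite /eEq tst_not /tst /=; lia. Qed.

Lemma tst_all f d s : tst w (eAll f d) s = all (fun i => tst w (f i) s) (iota 0 d).
Proof. by rewrite /eAll; elim: (iota 0 d) => //= i r <-; rewrite tst_and. Qed.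

Lemma tst_has f d s : tst w (eHas f d) s = has (fun i => tst w (f i) s) (iota 0 d).
Proof. by rewrite /eHas; elim: (iota 0 d) => //= i r <-; rewrite tst_or. Qed.

Lemma eval_mul c e s : eval w (eMul c e) s = c * eval w e s.
Proof. by elim: c => //= c ->; rewrite mulSn. Qed.

Lemma eval_const c s : eval w (Const c) s = c. Proof. by []. Qed.
Lemma eval_var x s : eval w (Var x) s = var s x. Proof. by []. Qed.
Lemma eval_arr a e s : eval w (Arr a e) s = arr s a (eval w e s). Proof. by []. Qed.
Lemma eval_add e1 e2 s : eval w (Add e1 e2) s = eval w e1 s + eval w e2 s.
Proof. by []. Qed.
Lemma tst_arr a e s : tst w (Arr a e) s = (0 < arr s a (eval w e s)).
Proof. by []. Qed.
Lemma tst_var x s : tst w (Var x) s = (0 < var s x). Proof. by []. Qed.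

Definition evalE := (eval_const, eval_var, eval_arr, eval_add).

Definition tstE := (tst_not, tst_or, tst_and, tst_lt, tst_eq).

Lemma den_seq c1 c2 s : den w (Seq c1 c2) s = den w c2 (den w c1 s).
Proof. by []. Qed.

Lemma den_when e c s : den w (When e c) s = if tst w e s then den w c s else s.
Proof. by []. Qed.

(** Besides the invariant, each pass may use that everything the body does not write still has its
    value from before the loop. *)
Lemma loop_ind (J : nat -> store -> Prop) x c s :
  J 0 s ->
  (forall i st, i < var s x ->
     (forall y, y \notin wvars c -> var st y = var s y) ->
     (forall a, a \notin warrs c -> arr st a = arr s a) ->
     J i st -> J i.+1 (den w c st)) ->
  J (var s x) (den w (Loop x c) s).
Proof.
move=> J0 JS /=.
suff h i : i <= var s x ->
  [/\ forall y, y \notin wvars c -> var (iter i (den w c) s) y = var s y,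
      forall a, a \notin warrs c -> arr (iter i (den w c) s) a = arr s a &
      J i (iter i (den w c) s)] by have [] := h _ (leqnn (var s x)).
elim: i => [|i IH] // ix; have [h1 h2 h3] := IH (ltnW ix); split=> /=.
- by move=> y hy; rewrite var_frame ?h1.
- by move=> a ha; rewrite arr_frame ?h2.
- exact: JS.
Qed.

End Tests.

(* Variables 1 to 11 and vd1 = d - 1 are computed first and serve as loop bounds;
   the search only changes variable 0 and those from 12 on. The bound vm is the
   number of clauses, vs = 2k + 1, vT is the number of steps, ve the number of
   digits per step, vB their base, vL = ve * vT, vQ = vB ^ vL and vX = 2 ^ k. *)
Local Notation vn := 1.
Local Notation vk := 2.
Local Notation vm := 3.
Local Notation vd := 4.
Local Notation ve := 5.
Local Notation vs := 6.
Local Notation vT := 7.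
Local Notation vB := 8.
Local Notation vL := 9.
Local Notation vQ := 10.
Local Notation vX := 11.
Local Notation vres := 12.
Local Notation vt := 13.
Local Notation vtt := 14.
Local Notation vq := 15.
Local Notation vdig := 16.
Local Notation vi := 17.
Local Notation vp := 18.
Local Notation vhl := 19.
Local Notation vbad := 20.
Local Notation vxn := 21.
Local Notation vtx := 22.
Local Notation vkill := 23.
Local Notation vacc := 24.
Local Notation vd1 := 25.
Local Notation aS := 0.
Local Notation aM := 1.
Local Notation aH := 2.
Local Notation aD := 3.
Local Notation aX := 4.

Definition incr x := Asg x (Add (Var x) (Const 1)).

(** Repeated subtraction. The loop makes [l] passes whatever the quotient is, and idles once the
    rest is below [b]; this keeps its bound independent of the body. *)
Definition divmod (y : nat) (b : expr) (l : nat) : cmd :=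
  Seq (Asg vq (Const 0)) (Seq
    (Loop l (When (eNot (eLt (Var y) b))
       (Seq (Asg y (Sub (Var y) b)) (incr vq))))
    (Seq (Asg vdig (Var y)) (Asg y (Var vq)))).

Definition for_i (l : nat) (c : cmd) : cmd :=
  Seq (Asg vi (Const 0)) (Loop l (Seq c (incr vi))).

Definition clear (a : nat) : cmd := for_i vn (Wr a (Var vi) (Const 0)).

Definition csz := Inp (Var vp).
(** The word at [vp] is the size of the clause, so the three words of a literal start one further
    on, and [r] is 1, 2 or 3. *)
Definition fld (r : nat) (i : expr) : expr :=
  Inp (Add (Add (Var vp) (Const r)) (Add i (Add i i))).
Definition sgn := fld 1.
Definition blk := fld 2.
Definition idx := fld 3.

Definition each_clause (c : cmd) : cmd :=
  Seq (Asg vp (Const 3))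
    (Loop vm (Seq c (Asg vp (Add (Var vp) (Add (Const 1) (eMul 3 csz)))))).

Definition eLits (d : nat) (f : expr -> expr) : expr :=
  eAll (fun i => eOr (eNot (eLt (Const i) csz)) (f (Const i))) d.

Definition open_expr d :=
  eLits d (fun i => eOr
    (eAnd (eNot (blk i)) (eNot (eEq (Arr aS (idx i)) (Add (sgn i) (Const 1)))))
    (eAnd (blk i) (eHas (fun g =>
       eEq (Arr aD (Const g)) (Add (Add (idx i) (idx i)) (sgn i))) d.-1))).

Definition consistent_expr d :=
  eLits d (fun i => eLits d (fun j =>
    eNot (eAnd (eAnd (eNot (blk i)) (eNot (blk j)))
               (eAnd (eEq (idx i) (idx j)) (eNot (eEq (sgn i) (sgn j))))))).

Definition free_expr i := eAnd (eNot (blk i)) (eNot (Arr aS (idx i))).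

Definition disjoint_expr d :=
  eLits d (fun i => eNot (eAnd (free_expr i) (Arr aM (idx i)))).

(** [aH] and [vhl] hold the list, and [aM] marks its members for the disjointness test. Like
    [free_vars], the list repeats a variable that occurs twice in a clause. *)
Definition hit_cmd d : cmd :=
  When (eAnd (eAnd (open_expr d) (consistent_expr d)) (disjoint_expr d))
    (for_i vd (When (eAnd (eLt (Var vi) csz) (free_expr (Var vi)))
       (Seq (Wr aM (idx (Var vi)) (Const 1))
         (Seq (Wr aH (Var vhl) (idx (Var vi))) (incr vhl))))).

Definition assign_cmd d : cmd :=
  for_i vd (When (eLt (Arr aD (Add (Const d.-1) (Var vi))) (Var vhl))
    (Wr aS (Arr aH (Arr aD (Add (Const d.-1) (Var vi))))
           (Add (Arr aD (Add (Const (d.-1 + d)) (Var vi))) (Const 1)))).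

Definition step_cmd d : cmd :=
  Seq (for_i ve (Seq (divmod vtt (Var vB) vQ) (Wr aD (Var vi) (Var vdig))))
    (Seq (clear aM) (Seq (Asg vhl (Const 0))
      (Seq (each_clause (hit_cmd d)) (assign_cmd d)))).

Definition false_lit i :=
  let v := eOr (eAnd (eNot (blk i)) (eLt (Const 1) (Arr aS (idx i))))
               (eAnd (blk i) (Arr aX (idx i))) in
  eOr (eAnd (sgn i) (eNot v)) (eAnd (eNot (sgn i)) v).

(** [vkill] records that the current x falsifies some clause; [vbad] survives only if all [2 ^ k] of
    them do. *)
Definition check_cmd d : cmd :=
  Seq (Asg vbad (Const 1)) (Seq (Asg vxn (Const 0))
    (Loop vX
      (Seq (Asg vtx (Var vxn))
      (Seq (for_i vk (Seq (divmod vtx (Const 2) vX) (Wr aX (Var vi) (Var vdig))))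
      (Seq (Asg vkill (Const 0))
      (Seq (each_clause (When (eLits d false_lit) (Asg vkill (Const 1))))
      (Seq (When (eNot (Var vkill)) (Asg vbad (Const 0)))
           (incr vxn)))))))).

Definition search_cmd d : cmd :=
  Seq (Asg vres (Const 1)) (Seq (Asg vt (Const 0))
    (Seq (Loop vQ
      (Seq (Asg vtt (Var vt))
      (Seq (clear aS)
      (Seq (Loop vT (step_cmd d))
      (Seq (check_cmd d)
      (Seq (When (Var vbad) (Asg vres (Const 0)))
           (incr vt)))))))
    (Asg 0 (Var vres)))).

Definition mul_cmd (x y : nat) : cmd :=
  Seq (Asg vacc (Const 0))
    (Seq (Loop y (Asg vacc (Add (Var vacc) (Var x)))) (Asg x (Var vacc))).

(** The set-up is cut into phases such that none of them assigns a variable that bounds one of its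
    own loops, as [runs_in_bound] requires. *)
Definition init1_cmd d : cmd :=
  Seq (Asg vn (Inp (Const 0))) (Seq (Asg vk (Inp (Const 1)))
  (Seq (Asg vm (Inp (Const 2))) (Seq (Asg vd (Const d))
  (Seq (Asg ve (Const (d.-1 + d + d)))
  (Seq (Asg vs (Add (Add (Var vk) (Var vk)) (Const 1)))
  (Seq (Asg vd1 (Const d.-1))
  (Seq (Asg vT (Const 1)) (Asg vX (Const 1))))))))).

(** [vT] first holds the number of groups, a power computed by repeated multiplication. *)
Definition init2_cmd : cmd :=
  Seq (Loop vk (Asg vX (Add (Var vX) (Var vX)))) (Loop vd1 (mul_cmd vT vs)).

Definition init3_cmd d : cmd :=
  Seq (Asg vT (eMul d.+1 (Var vT)))
  (Seq (Asg vB (eMul (d * d) (Var vT)))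
  (Seq (Asg vL (eMul (d.-1 + d + d) (Var vT))) (Asg vQ (Const 1)))).

Definition init4_cmd : cmd := Loop vL (mul_cmd vQ vB).

Definition main_cmd d : cmd :=
  Seq (init1_cmd d) (Seq init2_cmd (Seq (init3_cmd d) (Seq init4_cmd (search_cmd d)))).

Definition unit_init : cmd := Seq (Asg vres (Const 1)) (Asg vm (Inp (Const 2))).

(** Array 0 marks the codes of the literals read so far, so that a complementary literal is noticed.
    Universal literals are marked as well, but the answer is then already 0. *)
Definition unit_check : cmd :=
  let code b := Add (Add (idx (Const 0)) (idx (Const 0))) b in
  Seq (each_clause
      (Seq (When (eNot csz) (Asg vres (Const 0)))
           (When csz
             (Seq (When (eNot (blk (Const 0))) (Asg vres (Const 0)))
             (Seq (When (Arr 0 (code (eNot (sgn (Const 0))))) (Asg vres (Const 0)))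
                  (Wr 0 (code (sgn (Const 0))) (Const 1)))))))
    (Asg 0 (Var vres)).

Definition unit_cmd : cmd := Seq unit_init unit_check.

(** * Counted loops and division with remainder *)

Section Blocks.
Variable w : seq nat.
Local Notation dn := (den w).
Local Notation ev := (eval w).

Lemma for_iP (J : nat -> store -> Prop) l c s :
  l != vi -> vi \notin wvars c ->
  (forall i v st, J i st -> J i (Store (upd (var st) vi v) (arr st))) ->
  J 0 s ->
  (forall i st, i < var s l -> var st vi = i ->
     (forall y, y \notin vi :: wvars c -> var st y = var s y) ->
     (forall a, a \notin warrs c -> arr st a = arr s a) ->
     J i st -> J i.+1 (dn c st)) ->
  J (var s l) (dn (for_i l c) s).
Proof.
move=> li ci Jv J0 JS; rewrite /for_i den_seq.
set s0 := dn _ s; have -> : var s l = var s0 l by rewrite /= /upd (negbTE li).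
suff [] : var (dn (Loop l (Seq c (incr vi))) s0) vi = var s0 l /\
   J (var s0 l) (dn (Loop l (Seq c (incr vi))) s0) by [].
apply: (loop_ind (J := fun i st => var st vi = i /\ J i st)).
  by split=> //; apply: Jv.
move=> i st il fv fa [ivi Ji]; split.
  by rewrite /= /upd /= var_frame // ivi addn1.
apply: Jv; apply: JS => //.
- by move: il; rewrite /= /upd (negbTE li).
- move=> y; rewrite inE negb_or => /andP[y1 y2]; rewrite fv.
    by rewrite /= /upd (negbTE y1).
  by rewrite /= mem_cat inE negb_or y2.
- by move=> a ha; rewrite fa //= cats0.
Qed.

Lemma divmodP y b l s bv :
  l < 12 -> 12 <= y -> y != vq -> y != vdig -> 0 < bv -> var s y <= var s l ->
  (forall st, (forall x, x < 12 -> var st x = var s x) -> ev b st = bv) ->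
  let s' := dn (divmod y b l) s in
  var s' vdig = var s y %% bv /\ var s' y = var s y %/ bv.
Proof.
move=> l12 y12 yq yd b0 yl bE; rewrite /divmod !den_seq.
set s0 := dn (Asg vq _) s; set s1 := dn (Loop l _) s0.
have ys : var s0 y = var s y by rewrite /= /upd (negbTE yq).
have ls : var s0 l = var s l by rewrite /= /upd; case: eqP => // h; move: l12; rewrite h.
(* [i] is the number of subtractions made: either the rest is below [bv], or no pass was idle and,
   as [bv] is positive, [y] is used up. *)
suff : exists i, [/\ var s1 vq = i, var s1 y = var s y - i * bv, i * bv <= var s y &
   var s y - i * bv < bv \/ i = var s0 l].
  case=> i [h1 h2 h3 h4].
  have lt : var s y - i * bv < bv.
    case: h4 => // il; move: yl h3; rewrite -ls -il => h5 h6.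
    have : var s y <= i * bv by apply: leq_trans h5 _; rewrite leq_pmulr.
    by lia.
  have e : var s y = i * bv + (var s y - i * bv) by rewrite subnKC.
  rewrite /= /upd /= eq_sym (negbTE yd) h1 h2 eqxx; split.
    by rewrite [in RHS]e modnMDl modn_small.
  by rewrite [in RHS]e divnMDl // divn_small // addn0.
rewrite /s1; apply: (loop_ind (J := fun i st => exists j,
  [/\ var st vq = j, var st y = var s y - j * bv, j * bv <= var s y &
   var s y - j * bv < bv \/ j = i])).
  by exists 0; split=> //; [rewrite ys mul0n subn0|right].
move=> i st il fv fa [j [h1 h2 h3 h4]].
have evb : ev b st = bv.
  apply: bE => x x12; rewrite fv; last first.
    rewrite /= !inE negb_or; apply/andP; split; apply/eqP => h; move: x12; rewrite h //.
    by rewrite ltnNge y12.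
  by rewrite /= /upd; case: eqP => // h; move: x12; rewrite h.
rewrite den_when !tstE /= evb h2; case: (ltnP (var s y - j * bv) bv) => lt /=.
  by exists j; split=> //; left.
exists j.+1; case: h4 => [|ji]; first by rewrite ltnNge lt.
rewrite /upd /= (negbTE yq) eqxx [_ == y]eq_sym (negbTE yq) h1 addn1 mulSn; split=> //.
- by lia.
- by lia.
- by right; rewrite ji.
Qed.

End Blocks.

(** * Reading clauses from the input word *)

Section Den.
Variables (n k d : nat) (cs : seq (clause n k)).
Hypothesis size_cs : {in cs, forall C, size C <= d}.
Let w := [:: n; k; size cs] ++ flatten (map (@enc_clause n k) cs).

Local Notation dn := (den w).
Local Notation ev := (eval w).

Definition off (pre : seq (clause n k)) := 3 + size (flatten (map (@enc_clause n k) pre)).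

Lemma size_enc_lits (C : clause n k) :
  size (flatten (map (@enc_literal n k) C)) = 3 * size C.
Proof.
by elim: C => //= l C IH; rewrite size_cat IH; case: l => s [i|j] /=; lia.
Qed.

Lemma inp_clause pre C post r :
  cs = pre ++ C :: post -> r < size (enc_clause C) ->
  nth 0 w (off pre + r) = nth 0 (enc_clause C) r.
Proof.
move=> e h; pose A := flatten (map (@enc_clause n k) pre).
pose E := flatten (map (@enc_clause n k) post).
have -> : w = ([:: n; k; size cs] ++ A) ++ enc_clause C ++ E.
  by rewrite /w {2}e map_cat flatten_cat -catA.
have -> : off pre = size ([:: n; k; size cs] ++ A) by rewrite size_cat.
rewrite nth_cat ltnNge leq_addr [~~ true]/= addKn; by rewrite nth_cat h.
Qed.

(** The default literal [l0] is a parameter because no literal exists if [n] and [k] are both 0. *)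
Lemma nth_enc_lit (C : clause n k) i r l0 :
  i < size C -> r < 3 ->
  nth 0 (flatten (map (@enc_literal n k) C)) (3 * i + r) =
  nth 0 (enc_literal (nth l0 C i)) r.
Proof.
move=> + r3; have s3 (l : literal n k) : size (enc_literal l) = 3.
  by rewrite /enc_literal; case: l.2.
elim: C i => //= l C IH [|i] iC; rewrite nth_cat s3.
  by rewrite muln0 add0n r3.
by rewrite mulnS -addnA ltnNge leq_addr /= addKn IH.
Qed.

Section AtClause.
Variables (pre post : seq (clause n k)) (C : clause n k).
Hypothesis csE : cs = pre ++ C :: post.

Lemma cszP s : var s vp = off pre -> ev csz s = size C.
Proof. by move=> h; rewrite /= h -[off pre]addn0 (inp_clause csE). Qed.

Lemma fldP r ie l0 s :
  var s vp = off pre -> r < 3 -> ev ie s < size C ->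
  ev (fld r.+1 ie) s = nth 0 (enc_literal (nth l0 C (ev ie s))) r.
Proof.
move=> h r3 iC; rewrite -nth_enc_lit //= h.
set i := ev ie s in iC *.
have -> : off pre + r.+1 + (i + (i + i)) = off pre + (3 * i + r).+1 by lia.
rewrite (inp_clause csE) //= ltnS size_enc_lits; lia.
Qed.

Lemma next_clause s : var s vp = off pre ->
  ev (Add (Var vp) (Add (Const 1) (eMul 3 csz))) s = off (rcons pre C).
Proof.
move=> h; rewrite -[LHS]/(var s vp + (1 + ev (eMul 3 csz) s)).
rewrite eval_mul cszP // h /off -cats1 map_cat flatten_cat size_cat /=.
by rewrite cats0 size_enc_lits; lia.
Qed.

Lemma size_C : size C <= d.
Proof. by apply: size_cs; rewrite csE mem_cat inE eqxx orbT. Qed.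

Lemma litsP (f : expr -> expr) (F : literal n k -> bool) s :
  var s vp = off pre ->
  (forall i l0, i < size C -> tst w (f (Const i)) s = F (nth l0 C i)) ->
  tst w (eLits d f) s = all F C.
Proof.
move=> h hF; rewrite tst_all.
apply/allP/allP => [a l lC|a i]; last first.
  rewrite mem_iota add0n !tstE => /andP[_ id]; rewrite cszP //=.
  case: ltnP => //= iC; case: (C) hF a iC => // l0 C' hF a iC.
  by rewrite (hF i l0) // a // mem_nth.
have lt : index l C < size C by rewrite index_mem.
have := a (index l C); rewrite mem_iota add0n (leq_trans lt size_C) => /(_ isT).
by rewrite !tstE cszP //= lt (hF _ l) //= nth_index.
Qed.

Lemma blkP s ie l0 : var s vp = off pre -> ev ie s < size C ->
  tst w (blk ie) s = if (nth l0 C (ev ie s)).2 is inr _ then true else false.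
Proof.
by move=> h iC; rewrite /tst (fldP l0 h) // /enc_literal; case: (nth _ _ _).2.
Qed.

Lemma sgnP s ie l0 : var s vp = off pre -> ev ie s < size C ->
  ev (sgn ie) s = (nth l0 C (ev ie s)).1.
Proof.
by move=> h iC; rewrite /sgn (fldP l0 h) // /enc_literal; case: (nth _ _ _).2.
Qed.

Lemma idxP s ie l0 : var s vp = off pre -> ev ie s < size C ->
  ev (idx ie) s = match (nth l0 C (ev ie s)).2 with inl i => val i | inr j => val j end.
Proof.
by move=> h iC; rewrite /idx (fldP l0 h) // /enc_literal; case: (nth _ _ _).2.
Qed.

Lemma openP s : var s vp = off pre ->
  tst w (open_expr d) s = all (lit_open (mkseq (arr s aD) d.-1) (arr s aS)) C.
Proof.
move=> h; apply: litsP => // i l0 iC; rewrite !tstE !evalE tst_has.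
rewrite (blkP l0) // (sgnP l0) // (idxP l0) // !evalE /lit_open.
case E: (nth l0 C i).2 => [v|v] /=; rewrite ?orbF ?addn1 //.
have gE g : tst w (eEq (Arr aD (Const g)) (Add (Add (idx (Const i)) (idx (Const i)))
    (sgn (Const i)))) s = (arr s aD g == v.*2 + (nth l0 C i).1).
  by rewrite tst_eq !evalE (sgnP l0) // (idxP l0) // !evalE E addnn.
apply/hasP/mapP => [[g gi]|[g gi e]].
  by rewrite gE => /eqP e; exists g.
by exists g => //; rewrite gE e.
Qed.

Lemma consistentP s : var s vp = off pre ->
  tst w (consistent_expr d) s = consistent C.
Proof.
move=> h; apply: litsP => // i l0 iC; apply: litsP => // j l1 jC; rewrite !tstE.
rewrite (set_nth_default l0 l1 jC).
rewrite !(blkP l0) // !(sgnP l0) // !(idxP l0) // !evalE /clash.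
case: (nth l0 C i).2 => // u; case: (nth l0 C j).2 => // v.
by case: (nth l0 C i).1; case: (nth l0 C j).1.
Qed.

Lemma freeP s i l0 : var s vp = off pre -> ev i s < size C ->
  tst w (free_expr i) s = (free_var (arr s aS) (nth l0 C (ev i s)) != None).
Proof.
move=> h iC; rewrite !tstE (blkP l0) // tst_arr (idxP l0) // /free_var.
by case: (nth l0 C (ev i s)).2 => //= v; case: (arr s aS v).
Qed.

Lemma disjointP s (H : seq nat) : var s vp = off pre ->
  (forall v, v < n -> (0 < arr s aM v) = (v \in H)) ->
  tst w (disjoint_expr d) s = ~~ has (mem H) (free_vars (arr s aS) C).
Proof.
move=> h hM; rewrite -all_predC.
have -> : all (predC (mem H)) (free_vars (arr s aS) C) =
  all (fun l => if free_var (arr s aS) l is Some v then v \notin H else true) C.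
  by elim: (C) => //= l r <-; rewrite /free_vars /=; case: (free_var _ l).
apply: litsP => // i l0 iC; rewrite !tstE.
rewrite (blkP l0) // !tst_arr (idxP l0) // !evalE /free_var.
case: (nth l0 C i).2 => //= v; rewrite hM //.
by case: (arr s aS v).
Qed.

Lemma false_litP s (x : {ffun 'I_k -> bool}) : var s vp = off pre ->
  (forall j : 'I_k, (0 < arr s aX j) = x j) ->
  tst w (eLits d false_lit) s = all (predC (lit_val (total n (arr s aS)) x)) C.
Proof.
move=> h hX; apply: litsP => // i l0 iC.
have sE : tst w (sgn (Const i)) s = (nth l0 C i).1.
  by rewrite /tst (sgnP l0) // evalE; case: (nth l0 C i).1.
rewrite /false_lit !tstE sE (blkP l0) // !tst_arr !evalE (idxP l0) // !evalE /= /lit_val.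
case: (nth l0 C i).2 => v; rewrite ?ffunE ?hX /=.
  by case: (nth l0 C i).1; case: ltnP.
by case: (nth l0 C i).1; case: (x v).
Qed.

End AtClause.

(** The invariant speaks of the clauses already read and must be stable under changes of the pointer
    [vp], which advances after the body. *)
Lemma each_clauseP (J : seq (clause n k) -> store -> Prop) c s :
  vp \notin wvars c -> vm \notin wvars c -> var s vm = size cs ->
  (forall pre v st, J pre st -> J pre (Store (upd (var st) vp v) (arr st))) ->
  J [::] s ->
  (forall pre C post st, cs = pre ++ C :: post -> var st vp = off pre ->
     (forall y, y \notin vp :: wvars c -> var st y = var s y) ->
     (forall a, a \notin warrs c -> arr st a = arr s a) ->
     J pre st -> J (rcons pre C) (dn c st)) ->
  J cs (dn (each_clause c) s).
Proof.
move=> pc mc sm Jv J0 JS; rewrite /each_clause den_seq.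
set s0 := dn (Asg vp _) s.
have m0 : var s0 vm = size cs by [].
set bd := Seq c _.
suff : var (dn (Loop vm bd) s0) vp = off (take (var s0 vm) cs) /\
   J (take (var s0 vm) cs) (dn (Loop vm bd) s0).
  by move=> [_]; rewrite m0 take_size.
apply: (loop_ind (J := fun i st => var st vp = off (take i cs) /\ J (take i cs) st)).
  by rewrite take0; split=> //; apply: Jv.
move=> i st il fv fa [pE Ji]; rewrite m0 in il.
have [C [post [e eT]]] : exists C post, cs = take i cs ++ C :: post /\ take i.+1 cs = rcons (take i cs) C.
  case: cs il => // C0 cs' il; exists (nth C0 (C0 :: cs') i), (drop i.+1 (C0 :: cs')).
  by rewrite -drop_nth // cat_take_drop -take_nth.
rewrite eT den_seq; set st1 := dn c st.
have p1 : var st1 vp = off (take i cs) by rewrite var_frame.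
split.
  by rewrite -(next_clause e p1) /= /upd /=.
apply: Jv; apply: JS e pE _ _ Ji.
- move=> y; rewrite inE negb_or => /andP[y1 y2]; rewrite fv; first by rewrite /= /upd (negbTE y1).
  by rewrite /= mem_cat inE negb_or y2.
- by move=> a ha; rewrite fa //= cats0.
Qed.

End Den.

(** * Correctness of the search *)

Lemma iota_rcons m : iota 0 m.+1 = rcons (iota 0 m) m.
Proof. by rewrite -cats1 -addn1 iotaD. Qed.

(** * Numbers as sequences of digits *)

Section Digits.
Variable B : nat.
Hypothesis B_gt0 : 0 < B.

Definition digit (t i : nat) := (t %/ B ^ i) %% B.

Definition blocks (e T t : nat) : seq (seq nat) :=
  mkseq (fun j => mkseq (fun i => digit t (j * e + i)) e) T.

Lemma digitS t i : digit t i.+1 = digit (t %/ B) i.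
Proof. by rewrite /digit expnS divnMA. Qed.

Lemma digitD t i j : digit t (i + j) = digit (t %/ B ^ i) j.
Proof. by rewrite /digit expnD divnMA. Qed.

(** [v] is the number written [ds] in base [B], lowest digit first. The higher part [t] is
    arbitrary, so that blocks can be put in front of each other. *)
Lemma digits_val (ds : seq nat) : all (fun a => a < B) ds ->
  exists2 v, v < B ^ size ds & forall t, (v + B ^ size ds * t) %/ B ^ size ds = t /\
    forall i, i < size ds -> digit (v + B ^ size ds * t) i = nth 0 ds i.
Proof.
elim: ds => [|a ds IH] /=; first by exists 0 => // t; rewrite divn1 mul1n.
case/andP=> aB /IH[v vB vP]; exists (a + B * v).
  have : B * v.+1 <= B * B ^ size ds by rewrite leq_mul2l vB orbT.
  by rewrite expnS mulnS; lia.
move=> t; have -> : a + B * v + B ^ (size ds).+1 * t = (v + B ^ size ds * t) * B + a.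
  by rewrite expnS; lia.
set u := v + _.
have uB : (u * B + a) %/ B = u by rewrite divnMDl // divn_small // addn0.
have [v1 v2] := vP t; split; first by rewrite expnS divnMA uB.
case=> [|i] ii; first by rewrite /digit divn1 modnMDl modn_small.
by rewrite digitS uB v2.
Qed.

Lemma blocks_surj e (bl : seq (seq nat)) :
  all (fun b => (size b == e) && all (fun a => a < B) b) bl ->
  exists2 t, t < B ^ (e * size bl) & blocks e (size bl) t = bl.
Proof.
elim: bl => [|b bl IH] /=; first by exists 0; rewrite ?muln0.
case/andP=> /andP[/eqP be ba] /IH[t' tB tE].
have [v vB vP] := digits_val ba; rewrite be in vB vP.
have [q r] := vP t'; exists (v + B ^ e * t').
  have : B ^ e * t'.+1 <= B ^ e * B ^ (e * size bl) by rewrite leq_mul2l tB orbT.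
  by rewrite (mulnS e) expnD mulnS; lia.
rewrite /blocks /mkseq /= -add1n iotaDl -map_comp; congr (_ :: _).
  apply: (@eq_from_nth _ 0); first by rewrite size_map size_iota.
  move=> i; rewrite size_map size_iota => ie.
  by rewrite (nth_map 0) ?size_iota // nth_iota // ?mul0n ?add0n r.
rewrite -[RHS]tE; apply: eq_map => j /=; apply: eq_map => i.
by rewrite mulSn -addnA digitD q.
Qed.

End Digits.

(** * The commands of the search compute the candidates and test them *)

Section Search.
Variables (n k d T B Q X : nat) (cs : seq (clause n k)) (c : nat -> nat).
Hypothesis d_gt1 : 1 < d.
Hypothesis size_cs : {in cs, forall C, size C <= d}.
Hypothesis B_gt0 : 0 < B.
Hypothesis cE : [/\ c vn = n, c vk = k & [/\ c vm = size cs, c vd = d, c ve = d.-1 + d + d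
  & [/\ c vT = T, c vB = B, c vQ = Q & c vX = X]]].
Let w := [:: n; k; size cs] ++ flatten (map (@enc_clause n k) cs).
Let e := d.-1 + d + d.

Local Notation dn := (den w).
Local Notation ev := (eval w).

Definition ctx s := forall x, 0 < x < 12 -> var s x = c x.

Lemma notin12 (l : seq nat) y : all (leq 12) l -> y < 12 -> y \notin l.
Proof.
by move=> /allP al y12; apply/negP => /al; rewrite leqNgt y12.
Qed.

Lemma ctx_eq (l : seq nat) s st : all (leq 12) l ->
  (forall y, y \notin l -> var st y = var s y) -> ctx s -> ctx st.
Proof.
move=> al h cs0 x hx; rewrite h ?cs0 //; apply: notin12 => //.
by case/andP: hx.
Qed.

Lemma ctx_den cm s : all (leq 12) (wvars cm) -> ctx s -> ctx (dn cm s).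
Proof. by move=> al; apply: ctx_eq al _ => y hy; exact: var_frame. Qed.

Lemma clearP a s : ctx s -> forall v, v < n -> arr (dn (clear a) s) a v = 0.
Proof.
move=> cx; have sn : var s vn = n by rewrite cx //; case: cE.
rewrite -{1}sn /clear; apply: (for_iP (J := fun i st => forall v, v < i -> arr st a v = 0)) => //.
move=> i st il ivi _ _ h v vi1; rewrite /= /upd eqxx ivi.
by case: eqP => // /eqP vi2; apply: h; rewrite ltn_neqAle vi2 -ltnS.
Qed.

Lemma read_digitsP (y a l m : nat) b bv s :
  let c := for_i m (Seq (divmod y b l) (Wr a (Var vi) (Var vdig))) in
  l < 12 -> m < 12 -> 12 <= y -> y \notin [:: vq; vdig; vi] -> 0 < bv ->
  var s y <= var s l ->
  (forall st, (forall x, x < 12 -> var st x = var s x) -> ev b st = bv) ->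
  var (dn c s) y = var s y %/ bv ^ var s m /\
  forall i, i < var s m -> arr (dn c s) a i = digit bv (var s y) i.
Proof.
rewrite !inE !negb_or => c0 l12 m12 y12 /and3P[yq yd yi] b0 yl bE.
have nvi z : z < 12 -> z != vi by case: eqP => // ->.
apply: (for_iP (J := fun m st => var st y = var s y %/ bv ^ m /\
  forall i, i < m -> arr st a i = digit bv (var s y) i)) => //.
- exact: nvi.
- by rewrite /= !inE !(eq_sym vi) (negbTE yi).
- by move=> i v st; rewrite /= /upd (negbTE yi).
- by rewrite divn1.
move=> i st il ivi fv fa [h1 h2].
have low z : z < 12 -> var st z = var s z.
  move=> z12; rewrite fv //= !inE; apply/negP => h; move: z12.
  by move: h; do !case/orP; move=> /eqP -> //; rewrite ltnNge y12.
have [|||||||q1 q2] := @divmodP w y b l st bv; try by [].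
- by rewrite h1 low //; apply: leq_trans yl; exact: leq_div.
- by move=> s2 hs2; apply: bE => x x12; rewrite hs2 // low.
rewrite den_seq; set st1 := dn (divmod _ _ _) st in q1 q2 *.
have f1 : var st1 vi = i by rewrite var_frame //= !inE !(eq_sym vi) (negbTE yi).
have f2 : arr st1 a = arr st a by rewrite arr_frame.
clearbody st1; split; first by rewrite /= q2 h1 -divnMA -expnSr.
move=> j ji; rewrite /= /upd eqxx f1 f2 q1 h1 -/(digit _ _ _).
case: eqP => [-> //|/eqP jn]; rewrite h2 //.
by rewrite ltn_neqAle jn -ltnS.
Qed.

Definition stacked (H : seq nat) st :=
  [/\ var st vhl = size H, forall i, i < size H -> arr st aH i = nth 0 H i
    & forall v, v < n -> (0 < arr st aM v) = (v \in H)].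

(** The index expression is evaluated a second time after the first write, hence the two hypotheses
    on its value. *)
Lemma stacked_push H v st ie : ev ie st = v -> ev ie (dn (Wr aM ie (Const 1)) st) = v ->
  v < n -> stacked H st ->
  stacked (rcons H v) (dn (Seq (Wr aM ie (Const 1)) (Seq (Wr aH (Var vhl) ie) (incr vhl))) st).
Proof.
move=> e1 e2 vn [h1 h2 h3]; rewrite !den_seq.
set st1 := dn (Wr aM _ _) st in e2 *.
have a1 : arr st1 aM = upd (arr st aM) v 1 by rewrite /= /upd /= e1.
have a2 : arr st1 aH = arr st aH by [].
have a3 : var st1 = var st by [].
clearbody st1; split.
- by rewrite /= /upd /= a3 h1 size_rcons addn1.
- move=> i; rewrite size_rcons ltnS leq_eqVlt => ih.
  rewrite -[arr _ aH]/(upd (arr st1 aH) (var st1 vhl) (ev ie st1)).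
  rewrite a3 h1 e2 a2 /upd nth_rcons.
  by case: eqP ih => [->|/=]; rewrite ?ltnn //= => _ ih; rewrite ih h2.
- move=> u un; rewrite -[arr _ aM]/(arr st1 aM) a1 mem_rcons inE /upd.
  by case: eqP => //= _; rewrite h3.
Qed.

Lemma hit_cmdP s H pre C post : ctx s -> cs = pre ++ C :: post -> var s vp = off pre ->
  stacked H s ->
  stacked (hit_step (mkseq (arr s aD) d.-1) (arr s aS) H C) (dn (hit_cmd d) s).
Proof.
move=> cx csE sp sH; rewrite /hit_cmd den_when !tst_and.
rewrite (openP size_cs csE sp) (consistentP size_cs csE sp).
have [_ _ h3] := sH; rewrite (disjointP size_cs csE sp h3) /hit_step /cl_open.
case: ifP => // /andP[_ _].
have [_ _ [_ c4 _ _]] := cE.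
have sd : var s vd = d by rewrite cx.
(* The loop visits [d] positions; those past the end of [C] change nothing. *)
rewrite -(take_oversize (size_C size_cs csE)) -{1}sd.
apply: (for_iP (J := fun i st => stacked (H ++ free_vars (arr s aS) (take i C)) st)) => //.
  by rewrite take0 cats0.
move=> i st il ivi fv fa hst.
have stp : var st vp = off pre by rewrite fv.
have sts : arr st aS = arr s aS by rewrite fa.
rewrite den_when tst_and tst_lt (cszP csE stp) eval_var ivi.
case: (ltnP i (size C)) => iC; last first.
  by move: hst; rewrite andFb !take_oversize // (leq_trans iC).
have [l0 _] : exists l0 : literal n k, True by case: (C) iC => // l0; exists l0.
rewrite andTb (freeP csE l0 stp) eval_var ivi // sts.
rewrite (take_nth l0) // /free_vars -cats1 pmap_cat [pmap _ [:: _]]/=.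
have idE st' : var st' vp = off pre -> var st' vi = i ->
    ev (idx (Var vi)) st' = match (nth l0 C i).2 with inl i => val i | inr j => val j end.
  by move=> h1 h2; rewrite (idxP csE l0 h1) eval_var h2.
case E: (free_var (arr s aS) (nth l0 C i)) => [v|]; last by rewrite cats0.
have [vE vlt] : (match (nth l0 C i).2 with inl i => val i | inr j => val j end) = v /\ v < n.
  by move: E; rewrite /free_var; case: (nth l0 C i).2 => // u; case: ifP => // _ [<-].
rewrite [oapp _ _ _]/= catA cats1 -[X in stacked _ X]/(dn (Seq (Wr aM (idx (Var vi)) (Const 1))
         (Seq (Wr aH (Var vhl) (idx (Var vi))) (incr vhl))) st).
by apply: stacked_push; rewrite ?idE.
Qed.

Lemma hittingP s : ctx s -> var s vhl = 0 -> (forall v, v < n -> arr s aM v = 0) ->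
  let H := hitting cs (mkseq (arr s aD) d.-1) (arr s aS) in
  let s' := dn (each_clause (hit_cmd d)) s in
  var s' vhl = size H /\ forall i, i < size H -> arr s' aH i = nth 0 H i.
Proof.
move=> cx h0 m0 /=.
have [_ _ [c3 _ _ _]] := cE.
suff [] : stacked (hitting cs (mkseq (arr s aD) d.-1) (arr s aS))
   (dn (each_clause (hit_cmd d)) s) by [].
apply: (each_clauseP (J := fun pre st => stacked
  (foldl (hit_step (mkseq (arr s aD) d.-1) (arr s aS)) [::] pre) st)) => //.
- by rewrite cx.
- by split=> // v vn; rewrite m0.
move=> pre C post st csE stp fv fa hst; rewrite foldl_rcons.
have -> : arr s aD = arr st aD by rewrite fa.
have -> : arr s aS = arr st aS by rewrite fa.
apply: hit_cmdP csE stp _; last by rewrite !fa.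
by apply: ctx_eq fv cx.
Qed.

Lemma assign_cmdP s H : ctx s -> var s vhl = size H ->
  (forall i, i < size H -> arr s aH i = nth 0 H i) ->
  arr (dn (assign_cmd d) s) aS =
  foldl (fun sg i => assign H sg (arr s aD (d.-1 + i)) (arr s aD (d.-1 + d + i)))
    (arr s aS) (iota 0 d).
Proof.
move=> cx hl hH; have [_ _ [_ c4 _ _]] := cE.
have sd : var s vd = d by rewrite cx.
set F := fun _ _ => _; rewrite -[in RHS]sd.
apply: (for_iP (J := fun i st => arr st aS = foldl F (arr s aS) (iota 0 i))) => //.
move=> i st il ivi fv fa h.
rewrite iota_rcons foldl_rcons -h den_when tst_lt !evalE ivi.
rewrite fv // hl /F /assign -(fa aD) //; case: ifP => // lt.
rewrite -[LHS]/(upd (arr st aS) (arr st aH (arr st aD (d.-1 + var st vi)))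
  (arr st aD (d.-1 + d + var st vi) + 1)).
by rewrite ivi (fa aH) // hH // addn1.
Qed.

(** As [vtt] does not exceed [Q], the [vQ] passes of the division loop suffice. *)
Lemma step_cmdP s : ctx s -> var s vtt <= Q ->
  let s' := dn (step_cmd d) s in
  var s' vtt = var s vtt %/ B ^ e /\
  arr s' aS = guided_step cs d (arr s aS) (mkseq (digit B (var s vtt)) e).
Proof.
move=> cx tQ; have [_ _ [_ _ c5 [_ c8 c10 _]]] := cE.
rewrite /step_cmd 4!den_seq.
set s1 := dn (for_i ve _) s.
have se : var s ve = e by rewrite cx.
have [||||||| t1 d1] := @read_digitsP vtt aD vQ ve (Var vB) B s; try by [].
- by rewrite (cx vQ) // c10.
- by move=> st hst; rewrite evalE hst // cx.
rewrite -/s1 se in t1 d1.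
have x1 : ctx s1 by apply: ctx_den cx.
have a1 : arr s1 aS = arr s aS by rewrite arr_frame.
clearbody s1.
set s2 := dn (clear aM) s1.
have m2 := clearP aM x1; rewrite -/s2 in m2.
have x2 : ctx s2 by apply: ctx_den x1.
have a2 : arr s2 aS = arr s1 aS by rewrite arr_frame.
have d2 : arr s2 aD = arr s1 aD by rewrite arr_frame.
have t2 : var s2 vtt = var s1 vtt by rewrite var_frame.
clearbody s2.
set s3 := dn (Asg vhl _) s2.
have x3 : ctx s3 by apply: ctx_den x2.
have [l4 h4] := hittingP x3 (erefl : var s3 vhl = 0) m2.
set s4 := dn (each_clause _) s3 in l4 h4 *.
have x4 : ctx s4 by apply: ctx_den x3.
have a4 : arr s4 aS = arr s2 aS by rewrite arr_frame.
have d4 : arr s4 aD = arr s2 aD by rewrite arr_frame.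
have t4 : var s4 vtt = var s2 vtt by rewrite var_frame.
rewrite -[arr s3 aD]/(arr s2 aD) -[arr s3 aS]/(arr s2 aS) in l4 h4.
clearbody s4.
rewrite var_frame // t4 t2 t1; split=> //.
rewrite (assign_cmdP x4 l4 h4) a4 a2 a1 d4 d2 /guided_step.
have de i : i < d -> [/\ d.-1 + i < e & d.-1 + d + i < e].
  by rewrite /e => id; split; lia.
have le : d.-1 <= e by rewrite /e -addnA leq_addr.
have tk : take d.-1 (mkseq (digit B (var s vtt)) e) = mkseq (arr s1 aD) d.-1.
  apply: (@eq_from_nth _ 0); first by rewrite size_takel !size_mkseq.
  move=> i; rewrite size_takel ?size_mkseq // => hi.
  have ie := leq_trans hi le.
  by rewrite nth_take // !nth_mkseq // d1.
rewrite tk; move: (hitting _ _ _) => H.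
have : all (fun i => i < d) (iota 0 d) by apply/allP => i; rewrite mem_iota add0n.
elim: (iota 0 d) (arr s aS) => //= i r IH sg /andP[id ad].
by have [lt1 lt2] := de i id; rewrite IH // !nth_mkseq // !d1.
Qed.

Lemma stepsP s : ctx s -> var s vtt <= Q ->
  arr (dn (Loop vT (step_cmd d)) s) aS =
  run cs d (arr s aS) (blocks B e T (var s vtt)).
Proof.
move=> cx tQ; have [_ _ [_ _ _ [c7 _ _ _]]] := cE.
have sT : var s vT = T by rewrite cx.
rewrite -[in RHS]sT.
suff [] : var (dn (Loop vT (step_cmd d)) s) vtt = var s vtt %/ B ^ (var s vT * e) /\
   arr (dn (Loop vT (step_cmd d)) s) aS =
  run cs d (arr s aS) (blocks B e (var s vT) (var s vtt)) by [].
apply: (loop_ind (J := fun i st => var st vtt = var s vtt %/ B ^ (i * e) /\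
   arr st aS = run cs d (arr s aS) (blocks B e i (var s vtt)))).
  by rewrite mul0n divn1.
move=> i st il fv fa [h1 h2].
have [||q1 q2] := @step_cmdP st.
- by apply: ctx_eq fv cx.
- by rewrite h1; apply: leq_trans tQ; exact: leq_div.
split; first by rewrite q1 h1 -divnMA -expnD mulSn addnC.
rewrite q2 h2 /blocks mkseqS /run foldl_rcons; congr (guided_step _ _ _ _).
by apply: eq_map => j; rewrite h1 -digitD.
Qed.

Definition bits (x : nat) : {ffun 'I_k -> bool} := [ffun j : 'I_k => 0 < digit 2 x j].

Lemma bits_surj (x : {ffun 'I_k -> bool}) : exists2 v, v < 2 ^ k & bits v = x.
Proof.
pose ds := [seq nat_of_bool (x j) | j <- enum 'I_k].
have sd : size ds = k by rewrite size_map -cardE card_ord.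
have [|v v2 vP] := @digits_val 2 isT ds.
  by apply/allP => a /mapP[j _ ->]; case: (x j).
rewrite sd in v2 vP; exists v => //; apply/ffunP => j; rewrite ffunE.
have [_ /(_ j (ltn_ord j))] := vP 0; rewrite muln0 addn0 => ->.
by rewrite (nth_map j) ?size_enum_ord // nth_ord_enum; case: (x j).
Qed.

Lemma check_cmdP s : ctx s -> X = 2 ^ k ->
  (0 < var (dn (check_cmd d) s) vbad) =
  [forall x, ~~ cnf_val cs (total n (arr s aS)) x].
Proof.
move=> cx XE; have [_ c2 [c3 _ _ [_ _ _ c11]]] := cE.
set y := total n _.
have -> : [forall x, ~~ cnf_val cs y x] = all (fun i => ~~ cnf_val cs y (bits i)) (iota 0 X).
  apply/forallP/allP => [h i _|h x]; first exact: h.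
  by have [v v2 <-] := bits_surj x; apply: h; rewrite mem_iota add0n XE.
rewrite /check_cmd 2!den_seq; set s0 := dn (Asg vxn _) _.
have x0 : ctx s0 by apply: ctx_den => //; apply: ctx_den cx.
have aE : arr s0 aS = arr s aS by [].
have b0 : var s0 vbad = 1 by [].
have n0 : var s0 vxn = 0 by [].
clearbody s0.
have sX : var s0 vX = X by rewrite x0.
set bd := (X in Loop vX X); rewrite -sX.
suff [] : var (dn (Loop vX bd) s0) vxn = var s0 vX /\ (0 < var (dn (Loop vX bd) s0) vbad) =
   all (fun i => ~~ cnf_val cs y (bits i)) (iota 0 (var s0 vX)) by [].
apply: (loop_ind (J := fun i st => var st vxn = i /\ (0 < var st vbad) =
   all (fun i => ~~ cnf_val cs y (bits i)) (iota 0 i))); first by rewrite b0.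
move=> i st il fv fa [h1 h2]; rewrite /bd 5!den_seq.
have xs : ctx st by apply: ctx_eq fv x0.
set s1 := dn (Asg vtx _) st.
have x1 : ctx s1 by apply: ctx_den xs.
have t1 : var s1 vtx = i by [].
have e1 : var s1 vbad = var st vbad /\ var s1 vxn = i by [].
have as1 : arr s1 aS = arr s aS by rewrite -aE -(fa aS).
clearbody s1.
set s2 := dn (for_i vk _) s1.
have [||||||| _ d2] := @read_digitsP vtx aX vX vk (Const 2) 2 s1; try by [].
  by rewrite t1 x1 // c11 -sX ltnW.
rewrite -/s2 (x1 vk) // c2 in d2.
have x2 : ctx s2 by apply: ctx_den x1.
have e2 : var s2 vbad = var st vbad /\ var s2 vxn = i by rewrite !var_frame.
have as2 : arr s2 aS = arr s aS by rewrite arr_frame.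
clearbody s2.
set s3 := dn (Asg vkill _) s2.
have x3 : ctx s3 by apply: ctx_den x2.
set s4 := dn (each_clause _) s3.
have kE : (0 < var s4 vkill) = has (fun C => all (predC (lit_val y (bits i))) C) cs.
  apply: (each_clauseP (J := fun pre st => (0 < var st vkill) =
     has (fun C => all (predC (lit_val y (bits i))) C) pre)) => //.
    by rewrite x3.
  move=> pre C post st' csE sp fv' fa' h; rewrite den_when has_rcons.
  rewrite (false_litP size_cs csE (x := bits i)) //.
    rewrite fa' // -[arr s3 aS]/(arr s2 aS) as2 -/y.
    by case: ifP => //= _; rewrite -h.
  by move=> j; rewrite fa' // -[arr s3 aX]/(arr s2 aX) d2 // ffunE t1.
have e4 : var s4 vbad = var st vbad /\ var s4 vxn = i by rewrite !var_frame.
clearbody s4.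
rewrite iota_rcons all_rcons -h2.
have -> : ~~ cnf_val cs y (bits i) = (0 < var s4 vkill).
  by rewrite kE /cnf_val -has_predC; apply: eq_has => C /=; rewrite -all_predC.
rewrite den_when tstE tst_var; case: posnP => kl /=.
  by rewrite /upd /= (proj2 e4) addn1.
by rewrite /upd /= (proj2 e4) (proj1 e4) addn1.
Qed.

Lemma search_cmdP s : ctx s -> X = 2 ^ k ->
  var (dn (search_cmd d) s) 0 =
  all (fun t => [exists x, cnf_val cs (total n (run cs d (fun=> 0) (blocks B e T t))) x])
      (iota 0 Q).
Proof.
move=> cx XE; have [_ _ [_ _ _ [_ _ c10 _]]] := cE.
set P := fun _ => _.
rewrite /search_cmd 3!den_seq; set s0 := dn (Asg vt _) _.
have x0 : ctx s0 by apply: ctx_den => //; apply: ctx_den cx.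
have r0 : var s0 vres = 1 by [].
have t0 : var s0 vt = 0 by [].
clearbody s0.
have sQ : var s0 vQ = Q by rewrite x0.
set bd := (X in Loop vQ X); rewrite -sQ.
suff [_] : var (dn (Loop vQ bd) s0) vt = var s0 vQ /\
   var (dn (Loop vQ bd) s0) vres = all P (iota 0 (var s0 vQ)) by [].
apply: (loop_ind (J := fun i st => var st vt = i /\ var st vres = all P (iota 0 i))).
  by rewrite r0.
move=> i st il fv fa [h1 h2]; rewrite /bd 5!den_seq.
have xs : ctx st by apply: ctx_eq fv x0.
set s1 := dn (Asg vtt _) st.
have x1 : ctx s1 by apply: ctx_den xs.
have e1 : [/\ var s1 vtt = i, var s1 vres = var st vres & var s1 vt = i] by [].
clearbody s1.
set s2 := dn (clear aS) s1.
have m2 := clearP aS x1; rewrite -/s2 in m2.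
have x2 : ctx s2 by apply: ctx_den x1.
have e2 : [/\ var s2 vtt = i, var s2 vres = var st vres & var s2 vt = i].
  by rewrite !var_frame.
clearbody s2.
set s3 := dn (Loop vT _) s2.
have [e21 e22 e23] := e2.
have a3 : arr s3 aS = run cs d (arr s2 aS) (blocks B e T i).
  by rewrite /s3 stepsP // e21 // -sQ ltnW.
have x3 : ctx s3 by apply: ctx_den x2.
have e3 : var s3 vres = var st vres /\ var s3 vt = i by rewrite !var_frame.
clearbody s3.
set s4 := dn (check_cmd d) s3.
have b4 : (0 < var s4 vbad) = _ := check_cmdP x3 XE.
have e4 : var s4 vres = var st vres /\ var s4 vt = i by rewrite !var_frame.
clearbody s4.
rewrite iota_rcons all_rcons den_when tst_var b4 a3.
rewrite (@run_ext _ _ cs d _ (fun=> 0)); last by move=> v vn; rewrite m2.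
have -> : P i = ~~ [forall x, ~~ cnf_val cs (total n (run cs d (fun=> 0) (blocks B e T i))) x].
  by rewrite negb_forall; apply: eq_existsb => x; rewrite negbK.
case: ifP => _ /=; rewrite /upd /= (proj2 e4) addn1 //.
by rewrite (proj1 e4) h2.
Qed.

End Search.

(** * Computing the loop bounds *)

Section Init.
Variable w : seq nat.

Lemma mul_cmdP x y s : x != vacc -> y != vacc ->
  var (den w (mul_cmd x y) s) x = var s x * var s y.
Proof.
move=> xa ya; rewrite /mul_cmd den_seq; set s0 := den w (Asg vacc _) s.
have sy : var s y = var s0 y by rewrite /= /upd (negbTE ya).
have sx : var s0 x = var s x by rewrite /= /upd (negbTE xa).
have a0 : var s0 vacc = 0 by [].
clearbody s0; rewrite sy den_seq -sx.
set c := Asg vacc _.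
suff h : var (den w (Loop y c) s0) vacc = var s0 x * var s0 y by rewrite /= /upd eqxx.
rewrite mulnC; apply: (loop_ind (J := fun i st => var st vacc = i * var s0 x)) => //.
move=> i st _ fv _ h; rewrite /= /upd /= h fv; last by rewrite /= inE.
by rewrite mulSn addnC.
Qed.

Lemma pow_loopP x y z s : uniq [:: x; y; z; vacc] ->
  var (den w (Loop z (mul_cmd x y)) s) x = var s x * var s y ^ var s z.
Proof.
move=> u; rewrite /= !inE !negb_or !andbT in u.
have /andP[/and3P[xy xz xa] /andP[/andP[yz ya] za]] := u.
apply: (loop_ind (J := fun i st => var st x = var s x * var s y ^ i)).
  by rewrite muln1.
move=> i st _ fv _ h; rewrite mul_cmdP // h -mulnA; congr (_ * _).
by rewrite expnSr fv // /= !inE !(negbTE ya) eq_sym (negbTE xy).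
Qed.

Lemma double_loopP x z s : x != z ->
  var (den w (Loop z (Asg x (Add (Var x) (Var x)))) s) x = var s x * 2 ^ var s z.
Proof.
move=> xz; apply: (loop_ind (J := fun i st => var st x = var s x * 2 ^ i)).
  by rewrite muln1.
by move=> i st _ _ _ h; rewrite /= /upd eqxx h expnS; lia.
Qed.

End Init.

(** These are [d.+1 * N], the base [B] and the number of digit sequences from the completeness
    argument. *)
Definition nsteps (d k : nat) := d.+1 * (2 * k + 1) ^ d.-1.
Definition nbase (d k : nat) := d * (d * nsteps d k).
Definition nwords (d k : nat) := nbase d k ^ ((d.-1 + d + d) * nsteps d k).

Section Main.
Variables (n k d : nat) (cs : seq (clause n k)).
Hypothesis d_gt1 : 1 < d.
Let w := [:: n; k; size cs] ++ flatten (map (@enc_clause n k) cs).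

Definition search_start : store :=
  den w init4_cmd (den w (init3_cmd d) (den w init2_cmd (den w (init1_cmd d) (store0 w)))).

Lemma search_startP : let c := var search_start in
  [/\ c vn = n, c vk = k & [/\ c vm = size cs, c vd = d, c ve = d.-1 + d + d
  & [/\ c vT = nsteps d k, c vB = nbase d k, c vQ = nwords d k & c vX = 2 ^ k]]] /\
  c vs = 2 * k + 1 /\ c vL = (d.-1 + d + d) * nsteps d k.
Proof.
rewrite /search_start.
set s1 := den w (init1_cmd d) (store0 w).
have [n1 k1 [m1 d1 [e1 v1 [p1 t1 x1]]]] :
  [/\ var s1 vn = n, var s1 vk = k & [/\ var s1 vm = size cs, var s1 vd = d &
   [/\ var s1 ve = d.-1 + d + d, var s1 vs = 2 * k + 1 & [/\ var s1 vd1 = d.-1, var s1 vT = 1 &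
     var s1 vX = 1]]]].
  by split=> //; split=> //; split=> //; rewrite /s1 /= /upd /= addnn -mul2n.
clearbody s1.
set s2 := den w init2_cmd s1.
have x2 : var s2 vX = 2 ^ k.
  by rewrite /s2 /init2_cmd den_seq var_frame // double_loopP // x1 k1 mul1n.
have t2 : var s2 vT = (2 * k + 1) ^ d.-1.
  by rewrite /s2 /init2_cmd den_seq pow_loopP // !var_frame // t1 v1 p1 mul1n.
have [n2 k2 [m2 d2 [e2 v2]]] :
  [/\ var s2 vn = n, var s2 vk = k & [/\ var s2 vm = size cs, var s2 vd = d &
   [/\ var s2 ve = d.-1 + d + d & var s2 vs = 2 * k + 1]]].
  by rewrite !var_frame.
clearbody s2.
set s3 := den w (init3_cmd d) s2.
have T3 : var s3 vT = nsteps d k.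
  by rewrite /nsteps -t2 -[var s2 vT]/(eval w (Var vT) s2) -eval_mul.
have eE c st : eval w (eMul c (Var vT)) st = c * var st vT by rewrite eval_mul.
have B3 : var s3 vB = nbase d k.
  rewrite /nbase mulnA -T3 -[var s3 vB]/(eval w (eMul (d * d) (Var vT)) (den w (Asg vT (eMul d.+1 (Var vT))) s2)).
  by rewrite eE.
have L3 : var s3 vL = (d.-1 + d + d) * nsteps d k.
  rewrite -T3 -[var s3 vL]/(eval w (eMul (d.-1 + d + d) (Var vT)) (den w (Asg vB (eMul (d * d) (Var vT))) (den w (Asg vT (eMul d.+1 (Var vT))) s2))).
  by rewrite eE.
have Q3 : var s3 vQ = 1 by [].
have [n3 k3 [m3 d3 [e3 v3 x3]]] :
  [/\ var s3 vn = n, var s3 vk = k & [/\ var s3 vm = size cs, var s3 vd = d &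
   [/\ var s3 ve = d.-1 + d + d, var s3 vs = 2 * k + 1 & var s3 vX = 2 ^ k]]].
  by rewrite !var_frame.
clearbody s3.
have Q4 : var (den w init4_cmd s3) vQ = nwords d k.
  by rewrite /init4_cmd pow_loopP // Q3 mul1n B3 L3.
by cbv zeta; rewrite Q4 !var_frame.
Qed.

Hypothesis size_cs : {in cs, forall C, size C <= d}.

(** Each candidate is an assignment of y, so a true formula passes every test. For a false one,
    [guided_falsifies] provides the digits and [blocks_surj] a number below [nwords d k] that spells
    them. *)
Lemma main_cmdP : var (den w (main_cmd d) (store0 w)) 0 =
  [forall y : {ffun 'I_n -> bool}, [exists x : {ffun 'I_k -> bool}, cnf_val cs y x]].
Proof.
rewrite /main_cmd 4!den_seq -/search_start.
have [cE _] := search_startP.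
have B0 : 0 < nbase d k.
  have d0 := ltnW d_gt1.
  by rewrite !muln_gt0 d0 expn_gt0 addn1.
rewrite (search_cmdP d_gt1 size_cs B0 cE) //; congr (nat_of_bool _).
apply/allP/forallP => [h y|h t _]; last exact: h.
case: (boolP [exists x, cnf_val cs y x]) => // ne.
have hy x : ~~ cnf_val cs y x by apply/negP => hx; case/negP: ne; apply/existsP; exists x.
have [bl [/andP[/eqP sbl gbl] fbl]] := guided_falsifies d_gt1 size_cs hy.
have gbl' : all (fun b => (size b == d.-1 + d + d) && all (fun a => a < nbase d k) b) bl.
  by apply: sub_all gbl => b.
have [t tB tE] := blocks_surj B0 gbl'.
have /existsP[x] : [exists x, cnf_val cs (total n (run cs d (fun=> 0)
    (blocks (nbase d k) (d.-1 + d + d) (nsteps d k) t))) x].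
  by apply: h; rewrite mem_iota add0n /nwords; rewrite sbl in tB.
by rewrite /nsteps -sbl tE (negbTE (fbl x)).
Qed.

End Main.

(** * Running time and the case of unit clauses *)

Section Time.
Variables (n k d : nat) (cs : seq (clause n k)).
Hypothesis d_gt1 : 1 < d.
Let w := [:: n; k; size cs] ++ flatten (map (@enc_clause n k) cs).

Definition csize_main : nat :=
  csize (init1_cmd d) + csize init2_cmd + csize (init3_cmd d) + csize init4_cmd
  + csize (search_cmd d).

(** Every loop bound that depends on [d] and [k] only is at most the number of candidates; this
    includes [2 ^ k], the number of assignments tried by brute force. *)
Lemma leq_nwords : [/\ d.+2 <= nwords d k, d.-1 + d + d <= nwords d k, 2 * k + 1 <= nwords d k &
  [/\ nsteps d k <= nwords d k, nbase d k <= nwords d k,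
      (d.-1 + d + d) * nsteps d k <= nwords d k & 2 ^ k <= nwords d k]].
Proof.
set T := nsteps d k; set s := 2 * k + 1; set e := d.-1 + d + d.
have sP : s <= s ^ d.-1 by rewrite -{1}(expn1 s) leq_pexp2l /s //; lia.
have sT : d.+1 * s <= T by rewrite /T /nsteps leq_mul2l sP.
have T0 : 0 < T by rewrite (leq_trans _ sT) // /s addn1.
have BT : d * (d * T) = nbase d k by [].
have B2 : 2 <= nbase d k by rewrite -BT; case: (d) d_gt1 => [|[|d']] // _; nia.
have e0 : 0 < e by rewrite /e; lia.
have L0 : 0 < e * T by rewrite muln_gt0 e0.
have BQ : nbase d k <= nwords d k.
  by rewrite /nwords -{1}(expn1 (nbase d k)) leq_pexp2l // ltnW.
have LQ : e * T <= nwords d k.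
  by apply: ltnW; apply: ltn_expl.
have TB : T <= nbase d k by rewrite -BT; case: (d) d_gt1 => [|d'] // _; nia.
have sT' : s <= T by apply: leq_trans sT; rewrite mulSn leq_addr.
have kT : k <= e * T.
  by apply: leq_trans (leq_trans sT' (leq_pmull _ e0)); rewrite /s; lia.
split.
- apply: leq_trans BQ; rewrite -BT.
  have : d.+1 <= T by apply: leq_trans sT; rewrite leq_pmulr // /s addn1.
  by case: (d) d_gt1 => [|[|d']] // _; nia.
- by apply: leq_trans LQ; rewrite leq_pmulr.
- by apply: leq_trans LQ; apply: leq_trans sT' (leq_pmull _ e0).
- split=> //; first exact: leq_trans BQ.
  apply: leq_trans (leq_pexp2l (ltnW B2) kT).
  by case: (posnP k) => [->//|k0]; rewrite leq_exp2r.
Qed.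

(** Loops are nested four deep, for instance over candidates, assignments of x, bits of x, and the
    subtractions that extract a bit; hence the exponent 4. *)
Lemma main_cmd_time m : n <= m -> k <= m -> size cs <= m -> nwords d k <= m ->
  runs_in w (main_cmd d) (store0 w) (csize_main * m.+1 ^ 4).
Proof.
move=> nm km csm Qm.
have [q1 q2 q3 [q4 q5 q6 q7]] := leq_nwords.
have [[c1 c2 [c3 c4 c5 [c7 c8 c10 c11]]] [c6 c9]] := search_startP d cs.
have pw i : i <= 4 -> m.+1 ^ i <= m.+1 ^ 4 by move=> h; rewrite leq_pexp2l.
set s0 := store0 w.
set s1 := den w (init1_cmd d) s0.
set s2 := den w init2_cmd s1.
set s3 := den w (init3_cmd d) s2.
have r1 : runs_in w (init1_cmd d) s0 (csize (init1_cmd d) * m.+1 ^ 4).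
  apply: runs_in_le (@runs_in_bound w pred0 m (init1_cmd d) s0 isT isT _) => //.
  by rewrite leq_mul2l pw ?orbT.
have r2 : runs_in w init2_cmd s1 (csize init2_cmd * m.+1 ^ 4).
  apply: runs_in_le (@runs_in_bound w (pred3 vk vs vd1) m init2_cmd s1 isT isT _) => //.
    by rewrite leq_mul2l pw ?orbT.
  move=> x /or3P[] /eqP ->.
  - by [].
  - by rewrite /s1 /= /upd /=; lia.
  - by rewrite /s1 /= /upd /=; lia.
have r3 : runs_in w (init3_cmd d) s2 (csize (init3_cmd d) * m.+1 ^ 4).
  apply: runs_in_le (@runs_in_bound w pred0 m (init3_cmd d) s2 isT isT _) => //.
  by rewrite leq_mul2l pw ?orbT.
have r4 : runs_in w init4_cmd s3 (csize init4_cmd * m.+1 ^ 4).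
  apply: runs_in_le (@runs_in_bound w (pred2 vL vB) m init4_cmd s3 isT isT _) => //.
    by rewrite leq_mul2l pw ?orbT.
  have L3 : var s3 vL = (d.-1 + d + d) * nsteps d k.
    by rewrite -c9 /search_start var_frame.
  have B3 : var s3 vB = nbase d k by rewrite -c8 /search_start var_frame.
  by move=> x /orP[] /eqP ->; rewrite ?L3 ?B3; apply: leq_trans Qm.
have r5 : runs_in w (search_cmd d) (search_start d cs) (csize (search_cmd d) * m.+1 ^ 4).
  apply: (@runs_in_bound w (fun x => 0 < x < 12) m (search_cmd d) _ isT isT).
  case=> [//|]; do 11 (case=> [_|]; [rewrite ?c1 ?c2 ?c3 ?c4 ?c5 ?c6 ?c7 ?c8 ?c9 ?c10 ?c11;
    rewrite ?nm ?km ?csm //; apply: leq_trans Qm => //; lia | ]).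
  by [].
have r45 := runs_in_seq r4 (r5 : runs_in w _ (den w init4_cmd s3) _).
apply: runs_in_le (runs_in_seq r1 (runs_in_seq r2 (runs_in_seq r3 r45))).
rewrite /csize_main; move: (csize (init1_cmd d)) (csize init2_cmd) (csize (init3_cmd d)).
by move: (csize init4_cmd) (csize (search_cmd d)) => a1 a2 a3 a4 a5; rewrite !mulnDl !addnA.
Qed.

End Time.

(** For [k] at least 2, both the constant [A] and [2 * k + 1] are below fixed powers of [k], so the
    base is too, and the number of digits is at most a constant times [k ^ d.-1]. *)
Lemma nwords_bound d : 1 < d -> exists C K, forall k,
  nwords d k ^ 4 <= C * k ^ (K * k ^ (d - 1)).
Proof.
move=> d_gt1; rewrite subn1.
pose A := d * d * d.+1; pose e := d.-1 + d + d.
pose K := (A + 3 * d.-1) * (e * (d.+1 * 3 ^ d.-1)) * 4.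
(* At 0 and 1 the power of [k] is 1, at 0 because the exponent vanishes as [1 < d]; the constant
   carries the bound there. *)
exists (nwords d 0 ^ 4 + nwords d 1 ^ 4 + 1), K => -[|[|k']].
- have -> : 0 ^ d.-1 = 0 by rewrite exp0n //; lia.
  by rewrite muln0 muln1 -addnA leq_addr.
- by rewrite exp1n muln1 -addnA addnCA leq_addr.
set k := k'.+2; apply: leq_trans (leq_pmull _ _); last by rewrite addn1.
have s3 : 2 * k + 1 <= 3 * k by rewrite /k; lia.
have s4 : 2 * k + 1 <= k ^ 3.
  by rewrite expnS expnS expn1; apply: leq_trans s3 _; rewrite /k; nia.
have Bk : nbase d k <= k ^ (A + 3 * d.-1).
  rewrite expnD expnM.
  have -> : nbase d k = A * (2 * k + 1) ^ d.-1 by rewrite /nbase /nsteps /A; lia.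
  apply: leq_mul; first by apply: ltnW; apply: ltn_expl.
  by rewrite leq_exp2r //; lia.
have Tk : nsteps d k <= d.+1 * 3 ^ d.-1 * k ^ d.-1.
  rewrite /nsteps -mulnA leq_mul2l -expnMn leq_exp2r ?s3 ?orbT //; lia.
rewrite /nwords -expnM.
apply: leq_trans (_ : (k ^ (A + 3 * d.-1)) ^ (e * nsteps d k * 4) <= _).
  by case: (posnP (e * nsteps d k * 4)) => [->//|h]; rewrite leq_exp2r.
rewrite -expnM leq_pexp2l // /K.
rewrite -[X in _ <= X]mulnA -[X in _ <= X]mulnA leq_mul2l; apply/orP; right.
rewrite mulnA; apply: leq_trans (_ : e * (d.+1 * 3 ^ d.-1 * k ^ d.-1) * 4 <= _).
  by rewrite leq_mul2r leq_mul2l Tk !orbT.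
by lia.
Qed.

(** * Conflicts among unit clauses *)

Section Unit.
Variables (n k : nat).
Implicit Type cs : seq (clause n k).

Definition cnf_true cs : bool :=
  [forall y : {ffun 'I_n -> bool}, [exists x : {ffun 'I_k -> bool}, cnf_val cs y x]].

Definition ex_code (l : literal n k) : option nat :=
  if l.2 is inr j then Some (j.*2 + l.1) else None.

Definition has_code (a : nat) cs : bool :=
  has (fun C => has (fun l => ex_code l == Some a) C) cs.

Lemma cnf_true_rcons_nil cs : ~~ cnf_true (rcons cs [::]).
Proof.
apply/negP => /forallP /(_ [ffun=> false]) /existsP[x].
by rewrite /cnf_val all_rcons.
Qed.

Lemma cnf_true_rconsW cs C : cnf_true (rcons cs C) -> cnf_true cs.
Proof.
move=> /forallP h; apply/forallP => y; have /existsP[x] := h y.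
by rewrite /cnf_val all_rcons => /andP[_ hx]; apply/existsP; exists x.
Qed.

Lemma cnf_true_rcons_all cs b (i : 'I_n) : ~~ cnf_true (rcons cs [:: (b, inl i)]).
Proof.
apply/negP => /forallP /(_ [ffun=> ~~ b]) /existsP[x].
by rewrite /cnf_val all_rcons /= /lit_val /= ffunE; case: b.
Qed.

(** No x satisfies two opposite unit clauses. Without a conflict, resetting x_j to [b] keeps the old
    clauses true, because those on x_j have the sign [b]. *)
Lemma cnf_true_rcons_ex cs b (j : 'I_k) : all (fun C => size C <= 1) cs ->
  cnf_true cs ->
  cnf_true (rcons cs [:: (b, inr j)]) = ~~ has_code (j.*2 + ~~ b) cs.
Proof.
move=> sz /forallP h; apply/idP/idP => [/forallP h'|nc].
  apply/negP => /hasP[C Cs] /hasP[l lC]; rewrite /ex_code.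
  have /existsP[x] := h' [ffun=> false].
  rewrite /cnf_val all_rcons /= orbF => /andP[hb /allP/(_ C Cs)].
  have := allP sz C Cs; case: C lC {Cs} => // l' [] // lC _.
  move: lC; rewrite inE => /eqP <- /=; rewrite orbF.
  case: l => b' [//|j'] hl; rewrite /= => /eqP[e].
  have [eb ej] : b' = ~~ b /\ j' = j.
    by move: e; clear hl; case: b'; case: (b) => /= e; split=> //; try apply: ord_inj; lia.
  by move: hb hl; rewrite /lit_val /= eb ej => /eqP <-; case: (b).
apply/forallP => y; have /existsP[x hx] := h y; apply/existsP.
exists [ffun j' => if j' == j then b else x j'].
rewrite /cnf_val all_rcons /= /lit_val /= ffunE !eqxx /=.
apply/allP => C Cs; have := allP sz C Cs; have := allP hx C Cs.
case: C Cs => // -[b' [i|j']] [] // Cs; rewrite /= !orbF /lit_val //= ffunE.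
case: (eqVneq j' j) => [jj _ _|_ hb _ //]; case: (boolP (b' == b)) => // bb; case/negP: nc; apply/hasP.
exists [:: (b', inr j')] => //=; rewrite orbF /ex_code /= jj.
have e : b' = ~~ b by move: bb; clear; case: b'; case: b; rewrite ?eqxx.
by rewrite e eqxx.
Qed.

Lemma has_code_rcons a cs C :
  has_code a (rcons cs C) = has_code a cs || has (fun l => ex_code l == Some a) C.
Proof. by rewrite /has_code has_rcons orbC. Qed.

Variable cs : seq (clause n k).
Hypothesis size_cs : all (fun C => size C <= 1) cs.
Let w := [:: n; k; size cs] ++ flatten (map (@enc_clause n k) cs).

(** The marks are described only while the prefix read so far is true; a false prefix stays false,
    and the answer stays 0. *)
Lemma unit_cmdP : var (den w unit_cmd (store0 w)) 0 = cnf_true cs.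
Proof.
rewrite /unit_cmd den_seq /unit_init den_seq; set s0 := den w (Asg vm _) _.
have m0 : var s0 vm = size cs by [].
have r0 : var s0 vres = 1 by [].
have a0 : arr s0 = fun _ _ => 0 by [].
clearbody s0; rewrite /unit_check den_seq; set bd := (X in each_clause X).
suff [h _] : var (den w (each_clause bd) s0) vres = cnf_true cs /\
    (cnf_true cs -> forall a, (0 < arr (den w (each_clause bd) s0) 0 a) = has_code a cs) by [].
apply: (each_clauseP (J := fun pre st => var st vres = cnf_true pre /\
    (cnf_true pre -> forall a, (0 < arr st 0 a) = has_code a pre))) => //.
  split; last by rewrite a0.
  by rewrite r0 (_ : cnf_true [::]) //; apply/forallP => y; apply/existsP; exists [ffun=> false].
move=> pre C post st csE sp fv fa [h1 h2].
have zE s : var s vp = off pre -> tst w csz s = (0 < size C).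
  by move=> hs; rewrite /tst (cszP csE hs).
have szpre : all (fun C => size C <= 1) pre by move: size_cs; rewrite csE all_cat => /andP[].
have : size C <= 1 by apply: (allP size_cs); rewrite csE mem_cat inE eqxx orbT.
rewrite /bd den_seq; set st1 := den w (When _ _) st.
have st1E : st1 = if 0 < size C then st else den w (Asg vres (Const 0)) st.
  by rewrite /st1 den_when tst_not zE //; case: (0 < _).
have sp1 : var st1 vp = off pre by rewrite st1E; case: ifP.
rewrite den_when zE //; clearbody st1.
case: C csE zE st1E {fv fa} => [|l [|//]] csE zE st1E _.
  rewrite st1E (negbTE (cnf_true_rcons_nil pre)); split=> //.
rewrite [0 < _]/= 2!den_seq (st1E : st1 = st); set s1 := den w (When (eNot (blk (Const 0))) _) st.
have s1E : s1 = if l.2 is inr _ then st else den w (Asg vres (Const 0)) st.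
  by rewrite /s1 den_when tst_not (blkP csE l) //=; case: l.2.
clearbody s1; set s2 := den w (When (Arr _ _) _) s1.
have v1 : var s1 vp = off pre by rewrite s1E; case: l.2.
have r1 : var s1 vres = if l.2 is inr _ then cnf_true pre : nat else 0.
  by rewrite s1E; case: l.2 => // _; rewrite h1.
have a1 : arr s1 = arr st by rewrite s1E; case: l.2.
pose v := match l.2 with inl i => val i | inr j => val j end.
have s2E : s2 = if 0 < arr st 0 (v.*2 + ~~ l.1) then den w (Asg vres (Const 0)) s1 else s1.
  rewrite /s2 den_when tst_arr a1 !evalE (idxP csE l) // evalE -/v.
  rewrite -[eval w (eNot _) s1]/(1 - eval w (sgn (Const 0)) s1) (sgnP csE l) // evalE /=.
  by rewrite addnn; case: l.1.
clearbody s2.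
have v2 : var s2 vp = off pre by rewrite s2E; case: ifP.
have r2 : var s2 vres = if 0 < arr st 0 (v.*2 + ~~ l.1) then 0 else var s1 vres.
  by rewrite s2E; case: ifP.
have a2 : arr s2 = arr st by rewrite s2E -a1; case: ifP.
set s3 := den w (Wr _ _ _) s2.
have r3 : var s3 vres = var s2 vres by [].
have a3 : arr s3 0 = upd (arr st 0) (v.*2 + l.1) 1.
  rewrite -[arr s3 0]/(upd (arr s2 0) (eval w (idx (Const 0)) s2 + eval w (idx (Const 0)) s2
     + eval w (sgn (Const 0)) s2) 1).
  by rewrite a2 (idxP csE l) // (sgnP csE l) // !evalE -/v /= addnn.
clearbody s3; rewrite r3 a3 r2 r1 /v {v r2 a3 s2E v2 a2 r3 s1E r1 st1E zE csE}.
case: l => b [i|j] /=.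
  by rewrite (negbTE (cnf_true_rcons_all _ _ _)); case: ifP.
case: (boolP (cnf_true pre)) => tp; last first.
  rewrite (negbTE (contra (@cnf_true_rconsW _ _) tp)).
  by case: ifP.
rewrite cnf_true_rcons_ex // h2 //; split; first by case: (has_code _ _).
move=> _ a; rewrite has_code_rcons /= orbF /ex_code /upd /= (inj_eq (@Some_inj _)).
by rewrite eq_sym; case: eqP => //=; rewrite ?orbT ?orbF // h2.
Qed.

End Unit.

(** * The time bound in terms of the formula *)

Lemma leq_size_qbf phi : [/\ nall phi <= qbf_size phi, nex phi <= qbf_size phi &
  size (clauses phi) <= qbf_size phi].
Proof.
have h : size (clauses phi) <= \sum_(C <- clauses phi) (size C).+1.
  by rewrite -sum1_size leq_sum.
by rewrite /qbf_size; split; lia.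
Qed.

Theorem theorem3 :
  exists c : nat, forall d : nat,
  exists (P : program) (C K : nat), forall phi : qbf,
    is_dcnf d phi ->
    decides_within P phi
      (C * nex phi ^ (K * nex phi ^ (d - 1)) * qbf_size phi ^ c).
Proof.
(* The exponent is the nesting depth of the search, the same for every [d]. *)
exists 4 => d; case: (leqP d 1) => d1.
  (* With [K = 0] the factor in [k] is 1, even for [k = 0]. *)
  exists (compile unit_cmd), (csize unit_cmd * 2 + 2), 0 => phi dphi.
  have sz : all (fun C => size C <= 1) (clauses phi).
    by apply: sub_all dphi => C h; exact: leq_trans d1.
  have [_ _ sm] := leq_size_qbf phi.
  rewrite mul0n expn0 muln1.
  have t : runs_in (enc_qbf phi) unit_cmd (store0 (enc_qbf phi))
     (csize unit_cmd * (qbf_size phi).+1 ^ 1).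
    have t1 := @runs_in_bound (enc_qbf phi) pred0 0 unit_init (store0 (enc_qbf phi)) isT isT.
    have t2 : runs_in (enc_qbf phi) unit_check (den (enc_qbf phi) unit_init (store0 (enc_qbf phi)))
        (csize unit_check * (qbf_size phi).+1 ^ 1).
      by apply: (@runs_in_bound _ (pred1 vm) _ unit_check _ isT isT) => x /eqP ->.
    apply: runs_in_le (runs_in_seq (t1 _) t2) => //.
    by rewrite -[csize unit_cmd]/(csize unit_init + csize unit_check) mulnDl leq_add2r leq_mul2l.
  apply: (compileP t (unit_cmdP sz)).
  have S0 : 0 < qbf_size phi by [].
  have S1 : (qbf_size phi).+1 <= 2 * qbf_size phi ^ 4.
    apply: leq_trans (_ : 2 * qbf_size phi <= _); first by lia.
    by rewrite leq_mul2l /= -{1}(expn1 (qbf_size phi)) leq_pexp2l.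
  have S4 : 0 < qbf_size phi ^ 4 by rewrite expn_gt0 S0.
  rewrite expn1; move: (csize unit_cmd) (_ ^ 4) (_.+1) S1 S4 => a u v S1 S4.
  by have := leq_mul (leqnn a) S1; nia.
have [C1 [K hK]] := nwords_bound d1.
exists (compile (main_cmd d)), ((csize_main d * 16 + 2) * C1), K => phi dphi.
have sz : {in clauses phi, forall C, size C <= d} by move=> C Cs; exact: (allP dphi).
have [l1 l2 l3] := leq_size_qbf phi.
set S := qbf_size phi in l1 l2 l3 *.
set Q := nwords d (nex phi).
have Q0 : 0 < Q by have [h _ _ _] := leq_nwords (nex phi) d1; apply: leq_trans h.
have S0 : 0 < S by [].
have SQ : S <= S * Q by rewrite leq_pmulr.
(* [S * Q] dominates all loop bounds: [S] those read from the input, [Q] those computed from [d] and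
   [k]. *)
have t := main_cmd_time d1 (leq_trans l1 SQ) (leq_trans l2 SQ) (leq_trans l3 SQ)
   (leq_pmull Q S0).
apply: (compileP t (main_cmdP d1 sz)).
(* The factor 16 comes from bounding [(S * Q).+1] by twice [S * Q]. *)
have h1 : (S * Q).+1 ^ 4 <= 16 * (S ^ 4 * Q ^ 4).
  by rewrite -expnMn -[16]/(2 ^ 4) -expnMn leq_exp2r // -addn1; lia.
have h2 : Q ^ 4 <= _ := hK (nex phi).
have h3 : 0 < S ^ 4 * Q ^ 4 by rewrite muln_gt0 2!expn_gt0 S0 Q0.
set R := _ ^ (K * _) in h2 *.
apply: leq_trans (_ : (csize_main d * 16 + 2) * (S ^ 4 * Q ^ 4) <= _).
  rewrite mulnDl leq_add //; last by lia.
  by rewrite -mulnA leq_mul2l h1 orbT.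
rewrite -(mulnA _ C1 R) -(mulnA _ (C1 * R) (S ^ 4)) leq_mul2l; apply/orP; right.
by rewrite (mulnC (S ^ 4)) leq_mul2r h2 orbT.
Qed.
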